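(* Let $m>n$ and let $\Sigma$ be an $n$-dimensional complete (without boundary) self-shrinker properly immersed in $\mathbb{R}^m$. Let $k\in\{1,\ldots,n\}$. If $\Sigma$ is contained in $\overline{E^{k+1}(\sqrt{2k})}\times\mathbb{R}^{m-k-1}\subset\mathbb{R}^m$, then $\Sigma\subset S^k(\sqrt{2k})\times\mathbb{R}^{m-k-1}$.
   Context: An $n$-dimensional submanifold $\Sigma$ immersed in $\mathbb{R}^m$, $m>n$, is called a self-shrinker if $\mathbf{H}=-\frac12 X^N$, where $X$ is the position vector, $X^N$ is the component of $X$ normal to $\Sigma$, and $\mathbf{H}=\sum_{i=1}^n(\nabla_{E_i}E_i)^N$ is the mean curvature vector ($\{E_i\}$ a local orthonormal tangent frame of $\Sigma$, $\nabla$ the Euclidean connection), i.e. the trace of the second fundamental form. Inclusions of $\Sigma$ in subsets of $\mathbb{R}^m$ refer to the image of the immersion. Notation: $B^{k+1}(R)\subset\mathbb{R}^{k+1}$ is the (open) ball of radius $R$ centered at the origin, $\overline{A}$ is the closure of $A$, $E^{k+1}(R)=\mathbb{R}^{k+1}-\overline{B^{k+1}(R)}$, $S^k(R)\subset\mathbb{R}^{k+1}$ is the $k$-dimensional sphere of radius $R$ centered at the origin, and $\mathbb{R}^m=\mathbb{R}^{k+1}\times\mathbb{R}^{m-k-1}$. *)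

(* Defs.v *)
(* MathComp / MathComp-Analysis.  [R : realType] is the field of real numbers
   and R^d is ['rV[R]_d]; the topology of ['rV[R]_d] comes from the sup norm
   and is the usual one, while lengths and angles come from [dot] below. *)
From HB Require Import structures.
From mathcomp Require Import all_boot all_order all_algebra.
From mathcomp Require Import all_classical all_reals all_analysis.

Set Implicit Arguments.
Unset Strict Implicit.
Unset Printing Implicit Defensive.

Import Order.TTheory GRing.Theory Num.Theory.
Import numFieldNormedType.Exports.

Local Open Scope classical_set_scope.
Local Open Scope ring_scope.

Section Euclidean.
Context {R : realType}.

Definition dot d (u v : 'rV[R]_d) : R := \sum_(i < d) u 0 i * v 0 i.

Definition enorm d (u : 'rV[R]_d) : R := Num.sqrt (dot u u).

Definition eball d (r : R) : set 'rV[R]_d := [set x | enorm x < r].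
Arguments eball : clear implicits.

Definition exterior d (r : R) : set 'rV[R]_d := ~` closure (eball d r).
Arguments exterior : clear implicits.

Definition esphere k (r : R) : set 'rV[R]_k.+1 := [set x | enorm x = r].
Arguments esphere : clear implicits.

(* The product [A x R^(m-k-1)] inside R^m = R^(k+1) x R^(m-k-1), the factor
   R^(k+1) being spanned by the first [k.+1] coordinates. *)
Definition cylinder k m (hkm : (k < m)%N) (A : set 'rV[R]_k.+1) :
    set 'rV[R]_m :=
  [set x | A (\row_(i < k.+1) x 0 (widen_ord hkm i))].

(* [V = T (+) T^perp] when [T] is a linear subspace. *)
Definition orthogonal_complement d (T : set 'rV[R]_d) : set 'rV[R]_d :=
  [set w | forall v, T v -> dot w v = 0].

Definition normal_component d (T : set 'rV[R]_d) (v : 'rV[R]_d) : 'rV[R]_d :=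
  get [set w | orthogonal_complement T w /\ T (v - w)].

End Euclidean.

Arguments eball {R} d r.
Arguments exterior {R} d r.
Arguments esphere {R} k r.

Section Smooth.
Context {R : realType} {V W : normedModType R}.

(* To be used for open [U] and finite-dimensional [V] only: then this is the
   usual class C^k on [U], since ['D_v f] for fixed [v] is a fixed linear
   combination of the partial derivatives of [f]. *)
Fixpoint Ck (k : nat) (U : set V) (f : V -> W) : Prop :=
  match k with
  | 0 => forall x, U x -> {for x, continuous f}
  | j.+1 => (forall x, U x -> differentiable f x) /\
            (forall v : V, Ck j U ('D_v f))
  end.

Definition smooth (U : set V) (f : V -> W) : Prop := forall k, Ck k U f.

End Smooth.

(* [chart_map] and [chart_inv] are total functions, of which only the
   restrictions to [chart_dom] and [chart_cod] are meaningful. *)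
Record chart (R : realType) (n : nat) (M : topologicalType) := Chart {
  chart_dom : set M ;
  chart_cod : set 'rV[R]_n ;
  chart_map : M -> 'rV[R]_n ;
  chart_inv : 'rV[R]_n -> M ;
  chart_dom_open : open chart_dom ;
  chart_cod_open : open chart_cod ;
  chart_map_cod : forall p, chart_dom p -> chart_cod (chart_map p) ;
  chart_inv_dom : forall y, chart_cod y -> chart_dom (chart_inv y) ;
  chart_mapK : forall p, chart_dom p -> chart_inv (chart_map p) = p ;
  chart_invK : forall y, chart_cod y -> chart_map (chart_inv y) = y ;
  chart_map_continuous :
    forall p, chart_dom p -> {for p, continuous chart_map} ;
  chart_inv_continuous :
    forall y, chart_cod y -> {for y, continuous chart_inv} }.

Section Manifold.
Context {R : realType} {n : nat} {M : topologicalType}.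
Implicit Types A : set (chart R n M).

(* [M] with the (not necessarily maximal) atlas [A] is a smooth
   n-dimensional manifold without boundary; it need not be connected. *)
Definition smooth_manifold A : Prop :=
  [/\ hausdorff_space M, @second_countable M,
      forall p : M, exists2 c, A c & chart_dom c p &
      forall c d, A c -> A d ->
        smooth (chart_cod c `&` chart_inv c @^-1` chart_dom d)
               (chart_map d \o chart_inv c)].

(* Smoothness of a vector-valued map on an open subset [U] of [M]. *)
Definition smooth_map A m (U : set M) (f : M -> 'rV[R]_m) : Prop :=
  forall c, A c ->
    smooth (chart_cod c `&` chart_inv c @^-1` U) (f \o chart_inv c).

Definition smooth_curve A (g : R -> M) : Prop :=
  continuous g /\
  forall c, A c ->
    @smooth R R^o 'rV[R]_n (g @^-1` chart_dom c) (chart_map c \o g).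

Definition immersion A m (X : M -> 'rV[R]_m) : Prop :=
  smooth_map A setT X /\
  forall c y, A c -> chart_cod c y -> injective ('d (X \o chart_inv c) y).

Definition proper_map m (X : M -> 'rV[R]_m) : Prop :=
  continuous X /\ forall K, compact K -> compact (X @^-1` K).

Section Immersed.
Variables (A : set (chart R n M)) (m : nat) (X : M -> 'rV[R]_m).

(* The tangent space at [p], as a linear subspace of R^m. *)
Definition tangent_space (p : M) : set 'rV[R]_m :=
  [set v | exists c w, [/\ A c, chart_dom c p &
     'd (X \o chart_inv c) (chart_map c p) w = v]].

(* The Euclidean derivative [nabla_v Y] at [p] of an R^m-valued field [Y]
   along [X], for [v] in [tangent_space p]: if [v = dX(w)] in some chart,
   it is the derivative of [Y] in the direction [w] in the same chart. *)
Definition nabla (p : M) (v : 'rV[R]_m) (Y : M -> 'rV[R]_m) : 'rV[R]_m :=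
  get [set z | exists c w, [/\ A c, chart_dom c p,
     'd (X \o chart_inv c) (chart_map c p) w = v &
     z = 'd (Y \o chart_inv c) (chart_map c p) w]].

Definition normal_part (p : M) (v : 'rV[R]_m) : 'rV[R]_m :=
  normal_component (tangent_space p) v.

Definition orthonormal_tangent_frame (U : set M)
    (E : 'I_n -> M -> 'rV[R]_m) : Prop :=
  [/\ forall i, smooth_map A U (E i),
      forall p i, U p -> tangent_space p (E i p) &
      forall p i j, U p -> dot (E i p) (E j p) = (i == j)%:R].

(* [H] is the mean curvature vector at [p]; it does not depend on the frame. *)
Definition is_mean_curvature_vector (p : M) (H : 'rV[R]_m) : Prop :=
  exists (U : set M) (E : 'I_n -> M -> 'rV[R]_m),
    [/\ open U, U p, orthonormal_tangent_frame U E &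
        H = \sum_(i < n) normal_part p (nabla p (E i p) (E i))].

Definition self_shrinker : Prop :=
  forall p, is_mean_curvature_vector p (- 2^-1 *: normal_part p (X p)).

(* A curve is a geodesic of the induced metric iff its acceleration in R^m
   is normal, the Levi-Civita connection being the tangential part of the
   Euclidean one. *)
Definition geodesic (g : R -> M) : Prop :=
  smooth_curve A g /\
  forall t, orthogonal_complement (tangent_space (g t)) ((X \o g)^`(2)%classic t).

(* Geodesic completeness of the induced metric. *)
Definition complete_immersion : Prop :=
  forall p v, tangent_space p v ->
    exists g : R -> M, [/\ geodesic g, g 0 = p & (X \o g)^`()%classic 0 = v].

End Immersed.
End Manifold.

(* Main.v *)
Require Import Defs.
From mathcomp Require Import all_boot all_order all_algebra.
From mathcomp Require Import all_classical all_reals all_analysis.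
From mathcomp Require Import ring lra.
Import Order.TTheory GRing.Theory Num.Theory.
Import numFieldNormedType.Exports.
Local Open Scope classical_set_scope.
Local Open Scope ring_scope.

Set Implicit Arguments.
Unset Strict Implicit.
Unset Printing Implicit Defensive.

(** Let u be the squared length of the component of X in R^(k+1).  The
    hypothesis says that u >= 2k and the conclusion that u = 2k.

    On a self-shrinker, the operator L = Laplacian - <X^T, grad>/2 acts on an
    ambient function phi restricted to the immersed manifold by
      L phi = sum_i D^2 phi(E_i, E_i) - D phi(X)/2,
    since the mean curvature term D phi(H) = - D phi(X^N)/2 completes
    - D phi(X^T)/2.  For u this reads
      L u = 2 sum_i |front E_i|^2 - u,
    where [front] is the projection to R^(k+1).  The trace of this projection
    on an n-plane may exceed k, but Bessel's inequality, applied in the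
    hyperplane of R^(k+1) orthogonal to front X, bounds the sum by
    k + |grad u|^2 / (4u) ([front_trace_le]).  Hence
      L u <= 2k - u + |grad u|^2 / (2u),
    so that u is a supersolution up to a gradient term, and the maximum
    principle should force u = 2k.

    The maximum principle is used in one form only, [shrinker_min_test]: at a
    local minimum of u + g(|X - a|^2), the gradient of u is opposite to that
    of the second term, which leaves an inequality in g alone.  It is applied
    twice.

    With g(s) = - delta exp(- alpha s) it gives Hopf's argument, by which the
    contact set u = 2k is open ([hopf_barrier], [contact_set_open]).  The
    barrier is a function of the distance in R^m; it is effective because a
    short chord X - a of an immersion is nearly tangent ([chord_estimate],
    [chord_tangent]).

    With a = 0 and g(s) = eps s it replaces the parabolicity of the manifold.
    Let W be the set where u > 2k, which is now open and closed.  If W is not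
    empty, then u + eps |X|^2 has a minimum on W because X is proper, and
    there u <= 2k + 2 n eps and |X|^2 <= 4n, for small eps
    ([penalized_minimum]).  On the
    compact part |X|^2 <= 4n of W, however, u - 2k is bounded below by a
    positive constant, and a small eps gives a contradiction
    ([contact_set_full]).

    The test itself comes from second derivatives along straight lines of a
    chart ([curve_min_test]).  At a minimum the ambient gradient is normal,
    and in normal directions the second derivative of the parametrization
    along w agrees with the derivative nabla_E E of a tangent field E with
    E = dX(w) at the point ([normal_second_derivative]); this is how the mean
    curvature vector enters. *)

(** * The Euclidean inner product and the projection onto R^(k+1) *)

Section InnerProduct.
Context {R : realType} {m : nat}.
Implicit Types (u v w : 'rV[R]_m) (a : R).

Lemma dotC u v : dot u v = dot v u.
Proof. by apply: eq_bigr => i _; rewrite mulrC. Qed.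

Lemma dotDl u v w : dot (u + v) w = dot u w + dot v w.
Proof. by rewrite -big_split; apply: eq_bigr => i _; rewrite mxE mulrDl. Qed.

Lemma dotDr u v w : dot w (u + v) = dot w u + dot w v.
Proof. by rewrite dotC dotDl !(dotC w). Qed.

Lemma dotZl a u w : dot (a *: u) w = a * dot u w.
Proof. by rewrite mulr_sumr; apply: eq_bigr => i _; rewrite mxE mulrA. Qed.

Lemma dotZr a u w : dot w (a *: u) = a * dot w u.
Proof. by rewrite dotC dotZl (dotC w). Qed.

Lemma dotNl u w : dot (- u) w = - dot u w.
Proof. by rewrite -scaleN1r dotZl mulN1r. Qed.

Lemma dotNr u w : dot w (- u) = - dot w u.
Proof. by rewrite dotC dotNl (dotC w). Qed.

Lemma dotBl u v w : dot (u - v) w = dot u w - dot v w.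
Proof. by rewrite dotDl dotNl. Qed.

Lemma dotBr u v w : dot w (u - v) = dot w u - dot w v.
Proof. by rewrite dotDr dotNr. Qed.

Lemma dot0l w : dot 0 w = 0.
Proof. by rewrite -[0](scale0r 0) dotZl mul0r. Qed.

Lemma dot0r w : dot w 0 = 0.
Proof. by rewrite dotC dot0l. Qed.

Lemma dot_suml (I : Type) (r : seq I) (P : pred I) (F : I -> 'rV[R]_m) w :
  dot (\sum_(i <- r | P i) F i) w = \sum_(i <- r | P i) dot (F i) w.
Proof.
exact: (big_morph (fun u => dot u w) (fun u v => dotDl u v w) (dot0l w)).
Qed.

Lemma dot_sumr (I : Type) (r : seq I) (P : pred I) (F : I -> 'rV[R]_m) w :
  dot w (\sum_(i <- r | P i) F i) = \sum_(i <- r | P i) dot w (F i).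
Proof. by rewrite dotC dot_suml; apply: eq_bigr => i _; rewrite dotC. Qed.

Lemma dot_ge0 u : 0 <= dot u u.
Proof. by apply: sumr_ge0 => i _; rewrite -expr2 sqr_ge0. Qed.

Lemma dot_eq0 u : dot u u = 0 -> u = 0.
Proof.
move=> /eqP; rewrite psumr_eq0 => [/allP h|i _]; last by rewrite -expr2 sqr_ge0.
apply/rowP => i; rewrite mxE; apply/eqP.
by have := h i (mem_index_enum i); rewrite -expr2 sqrf_eq0.
Qed.

Lemma sqr_coord_le_dot u i : u 0 i ^+ 2 <= dot u u.
Proof.
rewrite /dot (bigD1 i) //= -expr2 lerDl.
by apply: sumr_ge0 => j _; rewrite -expr2 sqr_ge0.
Qed.

Lemma cauchy_schwarz u v : dot u v ^+ 2 <= dot u u * dot v v.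
Proof.
have [/dot_eq0 ->|v0] := eqVneq (dot v v) 0.
  by rewrite !dot0r expr0n mulr0.
have vv : 0 < dot v v by rewrite lt_neqAle eq_sym v0 dot_ge0.
have := dot_ge0 (dot v v *: u - dot u v *: v).
rewrite !(dotBl, dotBr, dotZl, dotZr) (dotC v u) => h.
rewrite -subr_ge0 -(pmulr_rge0 _ vv); apply: le_trans h _.
by rewrite le_eqVlt; apply/orP; left; apply/eqP; ring.
Qed.

Section Orthonormal.
Variables (n : nat) (E : 'I_n -> 'rV[R]_m).
Hypothesis orthoE : forall i j, dot (E i) (E j) = (i == j)%:R.

Lemma dot_orthonormal_suml (c : 'I_n -> R) j :
  dot (\sum_i c i *: E i) (E j) = c j.
Proof.
rewrite dot_suml (bigD1 j) //= dotZl orthoE eqxx mulr1 big1 ?addr0 // => i ij.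
by rewrite dotZl orthoE (negbTE ij) mulr0.
Qed.

Lemma bessel u : \sum_i dot u (E i) ^+ 2 <= dot u u.
Proof.
pose p := \sum_i dot u (E i) *: E i.
have pp : dot p p = \sum_i dot u (E i) ^+ 2.
  rewrite {2}/p dot_sumr; apply: eq_bigr => i _.
  by rewrite dotZr dot_orthonormal_suml expr2.
have up : dot u p = dot p p.
  by rewrite pp dot_sumr; apply: eq_bigr => i _; rewrite dotZr expr2.
have := dot_ge0 (u - p); rewrite !(dotBl, dotBr) (dotC p u) up -pp.
lra.
Qed.

Lemma dot_span u (c : 'I_n -> R) :
  dot u (\sum_i c i *: E i) = \sum_i c i * dot u (E i).
Proof. by rewrite dot_sumr; apply: eq_bigr => i _; rewrite dotZr. Qed.

(** For a vector [v] of the span, <u, v> only sees the projection of [u], whose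
    squared length is the sum on the right. *)
Lemma sqr_dot_span_le u (c : 'I_n -> R) (v := \sum_i c i *: E i) :
  dot u v ^+ 2 <= dot v v * \sum_i dot u (E i) ^+ 2.
Proof.
pose p := \sum_i dot u (E i) *: E i.
have -> : \sum_i dot u (E i) ^+ 2 = dot p p.
  rewrite /p dot_span; apply: eq_bigr => i _.
  by rewrite dot_orthonormal_suml expr2.
have -> : dot u v = dot v p.
  rewrite /v /p !dot_span; apply: eq_bigr => i _.
  by rewrite dot_orthonormal_suml mulrC.
exact: cauchy_schwarz.
Qed.

End Orthonormal.

(** The projection of R^m onto its factor R^(k+1), kept inside R^m so that
    [dot] applies to it and to position and tangent vectors alike. *)
Definition front k u : 'rV[R]_m := \row_j (if (j <= k)%N then u 0 j else 0).

Lemma dot_front k u v : dot (front k u) v = \sum_(j < m | (j <= k)%N) u 0 j * v 0 j.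
Proof.
rewrite /dot [RHS]big_mkcond; apply: eq_bigr => j _; rewrite mxE.
by case: ifP; rewrite ?mul0r.
Qed.

Lemma dot_frontr k u v : dot u (front k v) = dot (front k u) v.
Proof. by rewrite dotC !dot_front; apply: eq_bigr => j _; rewrite mulrC. Qed.

Lemma frontK k u : front k (front k u) = front k u.
Proof. by apply/rowP => j; rewrite !mxE; case: (j <= k)%N. Qed.

Lemma dot_front_front k u v : dot (front k u) (front k v) = dot (front k u) v.
Proof. by rewrite dot_frontr frontK. Qed.

Lemma front_coord k u (j : 'I_m) : (j <= k)%N -> front k u 0 j = u 0 j.
Proof. by rewrite mxE => ->. Qed.

Lemma dot_delta u j : dot u (delta_mx 0 j) = u 0 j.
Proof.
rewrite /dot (bigD1 j) //= mxE !eqxx mulr1 big1 ?addr0 // => i ij.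
by rewrite mxE (negbTE ij) andbF mulr0.
Qed.

(** The form v |-> |front v|^2 - <y, v>^2/|y|^2 is the squared length of the
    component of [v] in the k-dimensional complement of y = front u in R^(k+1).
    It is the sum of the <f_j, v>^2, where [f_j] is the component of the [j]-th
    basis vector in that complement; by Bessel its trace on the span of [E] is
    at most the sum of the |f_j|^2, that is (k + 1) - 1. *)
Lemma front_trace_le k n (E : 'I_n -> 'rV[R]_m) u :
  (k < m)%N -> (forall i j, dot (E i) (E j) = (i == j)%:R) ->
  0 < dot (front k u) (front k u) ->
  \sum_i dot (front k (E i)) (front k (E i)) <=
  k%:R + (\sum_i dot (front k u) (E i) ^+ 2) / dot (front k u) (front k u).
Proof.
move=> km orthoE; set y := front k u; set r := dot y y => r0.
have rE : \sum_(j < m | (j <= k)%N) y 0 j ^+ 2 = r.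
  rewrite /r {1}/y dot_front_front dot_front; apply: eq_bigr => j jk.
  by rewrite front_coord // expr2.
have yE v : \sum_(j < m | (j <= k)%N) y 0 j * v 0 j = dot y v.
  by rewrite dot_front; apply: eq_bigr => j jk; rewrite front_coord.
pose f (j : 'I_m) := delta_mx 0 j - (y 0 j / r) *: y.
have fE j i : dot (f j) (E i) = E i 0 j - y 0 j / r * dot y (E i).
  by rewrite dotBl dotZl dotC dot_delta.
have ff j : dot (f j) (f j) = 1 - y 0 j ^+ 2 / r.
  rewrite !(dotBl, dotBr, dotZl, dotZr) !(dotC _ y) !dot_delta -/r mxE !eqxx /=.
  by field; rewrite gt_eqF.
have card_k : \sum_(j < m | (j <= k)%N) (1 : R) = k.+1%:R.
  rewrite (big_ord_narrow (F := fun=> 1) km).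
  by rewrite sumr_const card_ord.
have step : \sum_(j < m | (j <= k)%N) \sum_i dot (f j) (E i) ^+ 2 <= k%:R.
  apply: le_trans (ler_sum _ (fun j _ => bessel orthoE (f j))) _.
  under eq_bigr do rewrite ff.
  rewrite sumrB card_k -mulr_suml rE divff ?gt_eqF // -natr1; lra.
suff H i : dot (front k (E i)) (front k (E i)) =
    \sum_(j < m | (j <= k)%N) dot (f j) (E i) ^+ 2 + dot y (E i) ^+ 2 / r.
  under eq_bigr do rewrite H.
  by rewrite big_split /= -mulr_suml lerD2r exchange_big.
under eq_bigr do rewrite fE sqrrB.
rewrite big_split sumrB /=.
have -> : \sum_(j < m | (j <= k)%N) E i 0 j ^+ 2 = dot (front k (E i)) (front k (E i)).
  by rewrite dot_front_front dot_front; apply: eq_bigr => j _; rewrite expr2.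
have -> : \sum_(j < m | (j <= k)%N) (E i 0 j * (y 0 j / r * dot y (E i)) *+ 2) =
    2 * dot y (E i) ^+ 2 / r.
  transitivity (dot y (E i) * (2 * dot y (E i) / r)); last by ring.
  by rewrite -[X in _ = X * _]yE mulr_suml; apply: eq_bigr => j _; ring.
have -> : \sum_(j < m | (j <= k)%N) (y 0 j / r * dot y (E i)) ^+ 2 =
    dot y (E i) ^+ 2 / r.
  transitivity (r * (dot y (E i) / r) ^+ 2); last by field; rewrite gt_eqF.
  rewrite -[X in _ = X * _]rE mulr_suml; apply: eq_bigr => j _; ring.
by field; rewrite gt_eqF.
Qed.

End InnerProduct.

(** * The second derivative test along curves *)

Section Calculus.
Context {R : realType}.

Lemma is_derive_coord (V : normedModType R) m (f : V -> 'rV[R]_m) x v df i :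
  is_derive x v f df -> is_derive x v (fun y => f y 0 i) (df 0 i).
Proof.
move=> [fd <-]; apply: DeriveDef; first by move/derivable_mxP: fd.
by rewrite derive_mx // mxE.
Qed.

Lemma is_derive_dot (V : normedModType R) m (f g : V -> 'rV[R]_m) x v df dg :
  is_derive x v f df -> is_derive x v g dg ->
  is_derive x v (fun y => dot (f y) (g y)) (dot df (g x) + dot (f x) dg).
Proof.
move=> fd gd.
have -> : (fun y => dot (f y) (g y)) =
    \sum_(i < m) ((fun y => f y 0 i) * (fun y => g y 0 i) : V -> R).
  by apply/funext => y; rewrite fct_sumE.
have h i : is_derive x v ((fun y => f y 0 i) * (fun y => g y 0 i) : V -> R)
    (df 0 i * g x 0 i + f x 0 i * dg 0 i).
  have fi := is_derive_coord i fd.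
  have gi := is_derive_coord i gd.
  by apply: is_derive_eq; rewrite addrC /GRing.scale /= mulrC.
by apply: is_derive_eq; rewrite big_split.
Qed.

Lemma is_derive_front m k (f : R -> 'rV[R]_m) (x : R) df :
  is_derive x 1 f df -> is_derive x 1 (front k \o f) (front k df).
Proof.
move=> fd.
have h i : is_derive x 1 (fun y => (front k \o f) y 0 i) (front k df 0 i).
  have -> : (fun y => (front k \o f) y 0 i) =
      (fun y => if (i <= k)%N then f y 0 i else 0).
    by apply/funext => y; rewrite /= mxE.
  rewrite mxE; case: (i <= k)%N; last exact: is_derive_cst.
  exact: is_derive_coord.
have hd : derivable (front k \o f) x 1.
  by apply/derivable_mxP => i j; rewrite (ord1 i); have [] := h j.
apply: DeriveDef => //; rewrite derive_mx //; apply/rowP => j.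
by rewrite mxE; have [_] := h j.
Qed.

(** Directional derivatives as derivatives of a function of one real variable,
    also away from the base point [y]. *)
Lemma is_derive_line (V W : normedModType R) (f : V -> W) y w (t : R) :
  differentiable f (y + t *: w) ->
  is_derive t 1 (fun s : R => f (y + s *: w)) ('D_w f (y + t *: w)).
Proof.
move=> fd.
have E : (fun h : R => h^-1 *: (f (y + (h *: (1 : R) + t) *: w) - f (y + t *: w))) =
         (fun h : R => h^-1 *: (f (h *: w + (y + t *: w)) - f (y + t *: w))).
  apply/funext => h; congr (_ *: (f _ - _)).
  by rewrite [h *: (1 : R)]mulr1 scalerDl addrCA.
have := @diff_derivable _ _ _ f _ w fd; rewrite /derivable => dd.
by apply: DeriveDef; rewrite /derivable /derive /= E.
Qed.

(** If the second derivative at 0 were negative, the first one would be negative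
    on some interval to the right of 0, and the function would decrease there. *)
Lemma second_derivative_test (psi dpsi : R -> R) (d2 : R) :
  (\forall t \near (0 : R), is_derive t (1 : R) psi (dpsi t)) ->
  is_derive (0 : R) (1 : R) dpsi d2 ->
  (\forall t \near (0 : R), psi 0 <= psi t) ->
  dpsi 0 = 0 /\ 0 <= d2.
Proof.
move=> hd hd2 hmin.
have [e /= e0 He] : exists2 e : R, 0 < e & forall t, `|t| < e ->
    is_derive t (1 : R) psi (dpsi t) /\ psi 0 <= psi t.
  have /nbhs_ballP[e /= e0 He] : \forall t \near (0 : R),
      is_derive t (1 : R) psi (dpsi t) /\ psi 0 <= psi t by exact: filterI.
  exists e => // t te; apply: He; rewrite /ball /= sub0r normrN //.
have d0 : dpsi 0 = 0.
  have h0 : is_derive (0 : R) 1 psi (dpsi 0) by have [] := He 0; rewrite ?normr0.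
  have [_ <-] := h0.
  suff [] : is_derive (0 : R) 1 psi 0 by [].
  apply: (@derive1_at_min _ psi (- e) e 0).
  - by lra.
  - move=> t; rewrite in_itv /= => /andP[t1 t2].
    have te : `|t| < e by rewrite ltr_norml t1 t2.
    by have [[]] := He t te.
  - by rewrite in_itv /= oppr_lt0 e0.
  - move=> t; rewrite in_itv /= => /andP[t1 t2].
    have te : `|t| < e by rewrite ltr_norml t1 t2.
    by have [] := He t te.
split => //; rewrite leNgt; apply/negP => d2lt.
have [eta /= eta0 Heta] : exists2 eta : R, 0 < eta & forall t, 0 < t -> t < eta ->
    dpsi t < 0.
  have [dd dE] := hd2.
  have : (fun h : R => h^-1 *: (dpsi (h *: (1:R) + 0) - dpsi 0)) @ 0^' --> d2.
    by rewrite -dE; exact: dd.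
  move=> /cvgrPdist_lt /(_ (- d2)); rewrite oppr_gt0 => /(_ d2lt).
  move=> /nbhs_ballP[eta /= eta0 Heta]; exists eta => // t t0 te.
  have := Heta t; rewrite /ball /= sub0r normrN gtr0_norm // => /(_ te).
  move=> /(_ (negbT (gt_eqF t0))).
  rewrite d0 subr0 addr0 [t *: (1:R)]mulr1 => /ltr_normlP[h _].
  have : t^-1 * dpsi t < 0.
    by move: h; rewrite /GRing.scale /=; lra.
  by rewrite pmulr_rlt0 ?invr_gt0.
pose t := Num.min e eta / 2.
have m0 : 0 < Num.min e eta by rewrite lt_min e0.
have t0 : 0 < t by rewrite divr_gt0.
have te : t < e.
  have : Num.min e eta <= e by rewrite ge_min lexx.
  by rewrite /t; lra.
have tn : t < eta.
  have : Num.min e eta <= eta by rewrite ge_min lexx orbT.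
  by rewrite /t; lra.
have hx s : 0 <= s -> s <= t -> is_derive s 1 psi (dpsi s).
  by move=> s0 st; have [] := He s; rewrite // ger0_norm // (le_lt_trans st).
have [||c] := @MVT R psi dpsi 0 t t0.
- by move=> s; rewrite in_itv /= => /andP[s0 st]; apply: hx; apply: ltW.
- apply: derivable_within_continuous => s; rewrite in_itv /= => /andP[s0 st].
  by have [] := hx s s0 st.
rewrite in_itv /= => /andP[c0 ct] hc.
have : psi 0 <= psi t by have [] := He t; rewrite // gtr0_norm.
rewrite -subr_ge0 hc subr0 pmulr_lge0 //.
by rewrite leNgt (Heta c c0 (lt_trans ct tn)).
Qed.

(** The vector [xi] is half the ambient gradient of |front z|^2 + g(|z - a|^2)
    at [x0], and the last sum is half the second derivative of this function
    along the curve; the acceleration [ddx] enters through [xi] only. *)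
Lemma curve_min_test m k (x dx : R -> 'rV[R]_m) (x0 v ddx : 'rV[R]_m)
    (a : 'rV[R]_m) (g dg : R -> R) (d2g : R) (s := dot (x0 - a) (x0 - a))
    (xi := front k x0 + dg s *: (x0 - a)) :
  x 0 = x0 -> dx 0 = v ->
  (\forall t \near (0 : R), is_derive t (1 : R) x (dx t)) ->
  is_derive (0 : R) (1 : R) dx ddx ->
  (forall r, is_derive r (1 : R) g (dg r)) -> is_derive s (1 : R) dg d2g ->
  (\forall t \near (0 : R),
     dot (front k x0) (front k x0) + g s <=
     dot (front k (x t)) (front k (x t)) + g (dot (x t - a) (x t - a))) ->
  dot xi v = 0 /\
  0 <= dot (front k v) (front k v) + dg s * dot v v
       + 2 * d2g * dot (x0 - a) v ^+ 2 + dot xi ddx.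
Proof.
move=> x0E vE; rewrite {}/xi {}/s -{}x0E -{}vE.
set s := dot (x 0 - a) _; set xi := _ + _ *: _.
move=> hx hdx hg hdg hmin.
pose sq t := dot (x t - a) (x t - a).
pose psi t := dot (front k (x t)) (front k (x t)) + g (sq t).
pose dsq t := 2 * dot (x t - a) (dx t).
pose dpsi t := 2 * dot (front k (x t)) (dx t) + dg (sq t) * dsq t.
have hxa t : is_derive t (1 : R) x (dx t) ->
    is_derive t (1 : R) (fun t => x t - a) (dx t).
  move=> h; have := is_deriveB h (is_derive_cst a t (1 : R)).
  by rewrite subr0.
have hsq t : is_derive t (1 : R) x (dx t) -> is_derive t (1 : R) sq (dsq t).
  move=> /hxa h; have := is_derive_dot h h.
  by rewrite (dotC (dx t)) -mulr2n -mulr_natl.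
have hx0 := nbhs_singleton hx.
have xiE u : dot xi u = dot (front k (x 0)) u + dg s * dot (x 0 - a) u.
  by rewrite [LHS]dotDl dotZl.
have hpsi : \forall t \near (0 : R), is_derive t (1 : R) psi (dpsi t).
  apply: filterS hx => t ht.
  have h1 := is_derive_front k ht.
  have h2 := is_derive_dot h1 h1.
  have h3 := is_derive1_comp (hg (sq t)) (hsq t ht).
  apply: (is_derive_eq (f := psi) (is_deriveD h2 h3)).
  congr (_ + _).
  by rewrite /= dotC dot_front_front; ring.
have hdpsi : is_derive (0 : R) (1 : R) dpsi
    (2 * (dot (front k (dx 0)) (front k (dx 0)) + dg s * dot (dx 0) (dx 0)
       + 2 * d2g * dot (x 0 - a) (dx 0) ^+ 2 + dot xi ddx)).
  have h1 := is_derive_dot (is_derive_front k hx0) hdx.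
  have h2 := is_derive_dot (hxa _ hx0) hdx.
  have h3 := is_derive1_comp hdg (hsq _ hx0).
  have h4 := is_deriveM h3 (is_deriveZ 2 h2).
  apply: (is_derive_eq (f := dpsi) (is_deriveD (is_deriveZ 2 h1) h4)).
  rewrite xiE dot_front_front /dsq /GRing.scale /= -[sq 0]/s.
  rewrite -[(2 : R) *: dot _ _]/(2 * dot _ _); ring.
have [h0 h2] := second_derivative_test hpsi hdpsi hmin.
split; last by move: h2; rewrite pmulr_rge0.
by move: h0; rewrite xiE /dpsi /dsq -/s; lra.
Qed.

End Calculus.

(** * Chords of immersed pieces *)

Section Immersions.
Context {R : realType}.

(* Here |u| is the sup norm of R^m; these lemmas compare it with
   the coordinates and with [dot]. *)
Lemma coord_le_norm m (u : 'rV[R]_m) i : `|u 0 i| <= `|u|.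
Proof.
rewrite [leRHS]/Num.Def.normr/= mx_normrE.
exact: (le_bigmax _ (fun ij : 'I_1 * 'I_m => `|u ij.1 ij.2|) (0, i)).
Qed.

Lemma norm_le_coord m (u : 'rV[R]_m) (e : R) : 0 <= e ->
  (forall i, `|u 0 i| <= e) -> `|u| <= e.
Proof.
move=> e0 h; rewrite [leLHS]/Num.Def.normr/= mx_normrE.
by apply: bigmax_le => // -[i j] _ /=; rewrite (ord1 i).
Qed.

Lemma sqr_norm_le_dot m (u : 'rV[R]_m) : `|u| ^+ 2 <= dot u u.
Proof.
rewrite -[leRHS](sqr_sqrtr (dot_ge0 u)) ler_pXn2r ?nnegrE ?sqrtr_ge0 //.
apply: norm_le_coord; first exact: sqrtr_ge0.
by move=> i; rewrite -sqrtr_sqr ler_wsqrtr // sqr_coord_le_dot.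
Qed.

Lemma dot_le_sqr_norm m (u : 'rV[R]_m) : dot u u <= m%:R * `|u| ^+ 2.
Proof.
rewrite mulr_natl -[X in _ *+ X]card_ord -sumr_const; apply: ler_sum => i _.
by rewrite -expr2 -real_normK ?num_real // ler_pXn2r ?nnegrE ?coord_le_norm.
Qed.

(** The constant comes from the entries of a matrix of a left inverse. *)
Lemma injective_linear_bound n m (f : {linear 'rV[R]_n -> 'rV[R]_m}) :
  injective f -> exists2 c : R, 0 < c & forall v, c * `|v| <= `|f v|.
Proof.
move=> finj.
have M_free : row_free (lin1_mx f).
  rewrite -kermx_eq0; apply/eqP/row_matrixP => i; rewrite row0.
  apply: finj; rewrite linear0 -mul_rV_lin1.
  by apply/sub_kermxP; exact: row_sub.
have /row_freeP[B MB] := M_free.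
pose S := \sum_i \sum_j `|B i j|.
have S0 : 0 <= S by apply: sumr_ge0 => i _; apply: sumr_ge0.
exists (S + 1)^-1; first by rewrite invr_gt0 ltr_wpDl.
move=> v; rewrite ler_pdivrMl ?ltr_wpDl //.
have E : v = f v *m B by rewrite -mul_rV_lin1 -mulmxA MB mulmx1.
rewrite [in leLHS]E.
apply: norm_le_coord => [|j]; first by rewrite mulr_ge0 // addr_ge0.
rewrite mxE; apply: le_trans (ler_norm_sum _ _ _) _.
apply: (@le_trans _ _ (\sum_i `|B i j| * `|f v|)).
  apply: ler_sum => i _; rewrite normrM mulrC ler_wpM2l // coord_le_norm //.
rewrite -mulr_suml ler_wpM2r // ler_wpDr // ler_sum // => i _.
by rewrite (bigD1 j) //= lerDl sumr_ge0.
Qed.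

Lemma diff_coord_sum n (W : normedModType R) (f : 'rV[R]_n -> W) y v :
  differentiable f y -> 'd f y v = \sum_i v 0 i *: 'D_(delta_mx 0 i) f y.
Proof.
move=> fd; rewrite [in LHS](row_sum_delta v) linear_sum.
by apply: eq_bigr => i _; rewrite linearZ deriveE.
Qed.

Lemma norm_perturb (V : normedModType R) (b a : V) (c t : R) :
  c * t <= `|b| -> `|a - b| <= c / 2 * t -> c / 2 * t <= `|a|.
Proof. by have := ler_normB a (a - b); rewrite subKr; lra. Qed.

Lemma coord_chord m (a b p q : 'rV[R]_m) j e :
  p 0 j - q 0 j = a 0 j -> `|a - b| <= e -> `|(p - q - b) 0 j| <= e.
Proof.
move=> E; apply: le_trans; rewrite !mxE E.
by have := coord_le_norm (a - b) j; rewrite !mxE.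
Qed.

(** The constant in the last hypothesis makes the error |p - v| at most
    |v| / (2 (m + 1)) in the sup norm, which absorbs the factor m lost when
    passing to the Euclidean norm. *)
Lemma chord_split m (p v : 'rV[R]_m) (c t : R) :
  0 < c -> 0 <= t -> c * t <= `|v| ->
  `|p - v| <= 2 * (c / (4 * m.+1%:R)) * t ->
  4 * dot (p - v) (p - v) <= dot v v /\ c ^+ 2 / 4 * t ^+ 2 <= dot p p.
Proof.
move=> c0 t0 vge; set M := m.+1%:R => errle.
have M1 : 1 <= M by rewrite ler1n.
have mM : m%:R <= M by rewrite ler_nat.
have M0 : M != 0 by rewrite pnatr_eq0.
have Mge0 : 0 <= M by rewrite ler0n.
have err1 : M * `|p - v| <= c / 2 * t.
  apply: le_trans (ler_wpM2l Mge0 errle) _.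
  by rewrite le_eqVlt; apply/orP; left; apply/eqP; field.
have err0 : 0 <= `|p - v| by [].
have err2 : `|p - v| <= c / 2 * t by apply: le_trans err1; rewrite ler_peMl.
have ct : 0 <= c * t by rewrite mulr_ge0 // ltW.
split.
  apply: (le_trans _ (sqr_norm_le_dot v)).
  have h1 : (c * t) ^+ 2 <= `|v| ^+ 2 by rewrite ler_pXn2r // nnegrE.
  have h2 : (M * `|p - v|) ^+ 2 <= (c / 2 * t) ^+ 2.
    by rewrite ler_pXn2r // nnegrE ?mulr_ge0 // ?divr_ge0 // ltW.
  have h3 := dot_le_sqr_norm (p - v).
  have h4 : m%:R * `|p - v| ^+ 2 <= M ^+ 2 * `|p - v| ^+ 2.
    by rewrite ler_wpM2r ?exprn_ge0 // (le_trans mM) // expr2 ler_peMl.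
  have h5 : (c / 2 * t) ^+ 2 = (c * t) ^+ 2 / 4 by field.
  by move: h2; rewrite h5 exprMn; lra.
apply: (le_trans _ (sqr_norm_le_dot p)).
have -> : c ^+ 2 / 4 * t ^+ 2 = (c / 2 * t) ^+ 2 by field.
rewrite ler_pXn2r ?nnegrE //; last by rewrite mulr_ge0 // divr_ge0 // ltW.
have := ler_normB p (p - v); rewrite subKr; lra.
Qed.

(** If a chord [d] is within half the length of a vector [v], a bound [tau] for
    the squared length of the component of [d] along [v] also bounds the
    squared length of [d], up to a constant. *)
Lemma chord_tangent m (d v : 'rV[R]_m) (tau : R) : 0 <= tau ->
  4 * dot (d - v) (d - v) <= dot v v -> dot d v ^+ 2 <= dot v v * tau ->
  dot d d <= 9 * tau.
Proof.
move=> tau0; have [e ->] : exists e, d = v + e by exists (d - v); rewrite addrC subrK.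
rewrite addrAC subrr add0r !(dotDl, dotDr) (dotC v e) => h1 h2.
have h3 := cauchy_schwarz e v.
move: h1 h2 h3 (dot_ge0 e) (dot_ge0 v).
move: (dot e e) (dot v v) (dot e v) => ee V ev h1 h2 h3 ee0 V0.
have ev1 : `|ev| <= V / 2.
  rewrite -(ler_pXn2r (n := 2)) ?nnegrE ?divr_ge0 // real_normK ?num_real //.
  by rewrite (le_trans h3) // expr_div_n; nra.
move: ev1; rewrite ler_norml => /andP[ev1 ev2].
have [V1|V1] := ltP 0 V; last by nra.
have h4 : V / 4 <= tau.
  by rewrite -(ler_pM2l V1) (le_trans _ h2) //; nra.
by lra.
Qed.

Section AtPoint.
Variables (n m : nat) (f : 'rV[R]_n -> 'rV[R]_m) (y0 : 'rV[R]_n).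
Hypothesis fdiff : \forall y \near y0, differentiable f y.
Hypothesis fC1 : forall v, {for y0, continuous ('D_v f)}.

(** The differential depends continuously on the point, uniformly over unit
    vectors, as it is determined by finitely many partial derivatives. *)
Lemma diff_near (e : R) : 0 < e ->
  \forall y \near y0, forall v, `|'d f y v - 'd f y0 v| <= e * `|v|.
Proof.
move=> e0; have n0 : 0 < n.+1%:R :> R by [].
pose d := e / n.+1%:R.
have d0 : 0 < d by rewrite divr_gt0.
have fd0 := nbhs_singleton fdiff.
have H : \forall y \near y0, forall i : 'I_n,
    `|'D_(delta_mx 0 i) f y0 - 'D_(delta_mx 0 i) f y| <= d.
  apply: (@filter_forall _ _ (fun (i : 'I_n) y =>
    `|'D_(delta_mx 0 i) f y0 - 'D_(delta_mx 0 i) f y| <= d) (nbhs y0)) => i.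
  by have /cvgrPdist_le := @fC1 (delta_mx 0 i); apply.
near=> y => v.
have fy : differentiable f y by near: y.
have Hy : forall i : 'I_n,
    `|'D_(delta_mx 0 i) f y0 - 'D_(delta_mx 0 i) f y| <= d by near: y.
have -> : 'd f y v - 'd f y0 v = \sum_i v 0 i *:
    ('D_(delta_mx 0 i) f y - 'D_(delta_mx 0 i) f y0).
  under eq_bigr do rewrite scalerBr.
  rewrite [RHS]sumrB; congr (_ - _).
    exact: diff_coord_sum fy.
  exact: diff_coord_sum fd0.
apply: le_trans (ler_norm_sum _ _ _) _.
apply: (@le_trans _ _ (\sum_(i < n) `|v| * d)).
  apply: ler_sum => i _; rewrite normrZ ler_pM // ?coord_le_norm //.
  by rewrite distrC.
rewrite sumr_const card_ord -mulrnAr mulrC ler_wpM2r // /d.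
rewrite -mulrnAl ler_pdivrMr // -mulr_natr ler_pM2l // ler_nat //.
Unshelve. all: by end_near. Qed.

Hypothesis finj : injective ('d f y0).

Lemma diff_bounded_below :
  exists2 c : R, 0 < c & \forall y \near y0, forall v, c * `|v| <= `|'d f y v|.
Proof.
have [c c0 Hc] := injective_linear_bound finj.
exists (c / 2); first by rewrite divr_gt0.
near=> y => v.
have H : `|'d f y v - 'd f y0 v| <= c / 2 * `|v|.
  by move: v; near: y; apply: diff_near; rewrite divr_gt0.
exact: norm_perturb (Hc v) H.
Unshelve. all: by end_near. Qed.

(** By the mean value theorem, f x - f q differs from the fixed linear map
    'd f y0 applied to x - q by little, and so does 'd f x (x - q).  Both end
    points of the chord are free: the barrier below is centred at [q] and is
    used at an unknown [x]. *)
Lemma chord_estimate :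
  exists rho c : R, [/\ 0 < rho, 0 < c &
    forall x q, `|x - y0| <= rho -> `|q - y0| <= rho ->
      let v := 'd f x (x - q) in let e := f x - f q - v in
      4 * dot e e <= dot v v /\
      c * `|x - q| ^+ 2 <= dot (f x - f q) (f x - f q)].
Proof.
have [c c0 Hc] := diff_bounded_below.
pose e := c / (4 * m.+1%:R).
have m0 : 0 < m.+1%:R :> R by [].
have e0 : 0 < e by rewrite divr_gt0 // mulr_gt0.
have : \forall y \near y0, [/\ differentiable f y,
    forall v, `|'d f y v - 'd f y0 v| <= e * `|v| &
    forall v, c * `|v| <= `|'d f y v|].
  by near=> y; split; near: y => //; apply: diff_near.
move=> /nbhs_ballP[r /= r0 Hr].
have {}Hr y : `|y - y0| <= r / 2 -> [/\ differentiable f y,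
    forall v, `|'d f y v - 'd f y0 v| <= e * `|v| &
    forall v, c * `|v| <= `|'d f y v|].
  move=> yr; apply: Hr; rewrite -ball_normE /= distrC (le_lt_trans yr) //.
  by rewrite ltr_pdivrMr // ltr_pMr // ltr1n.
exists (r / 2), (c ^+ 2 / 4); split; try by rewrite divr_gt0 // exprn_gt0.
move=> x q xr qr; set v := 'd f x (x - q); set err := f x - f q - v.
pose z t := q + t *: (x - q).
have zr t : 0 <= t -> t <= 1 -> `|z t - y0| <= r / 2.
  move=> t0 t1; have -> : z t - y0 = t *: (x - y0) + (1 - t) *: (q - y0).
    apply/rowP => i; rewrite !mxE; ring.
  apply: le_trans (ler_normD _ _) _; rewrite !normrZ !ger0_norm ?subr_ge0 //.
  have h1 : t * `|x - y0| <= t * (r / 2) by rewrite ler_wpM2l.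
  have h2 : (1 - t) * `|q - y0| <= (1 - t) * (r / 2).
    by rewrite ler_wpM2l // subr_ge0.
  by lra.
(* The mean value theorem is applied to each coordinate on the segment [z]. *)
have mvt : `|f x - f q - 'd f y0 (x - q)| <= e * `|x - q|.
  apply: norm_le_coord => [|j]; first by rewrite mulr_ge0 // ltW.
  have zd (t : R) : 0 <= t -> t <= 1 ->
      is_derive t (1 : R) (fun s => f (z s) 0 j) ('d f (z t) (x - q) 0 j).
    move=> t0 t1; have [fz _ _] := Hr _ (zr t t0 t1).
    by apply: is_derive_coord; rewrite -deriveE //; exact: is_derive_line.
  have [||t] := @MVT R (fun s => f (z s) 0 j)
      (fun t => 'd f (z t) (x - q) 0 j) 0 1 ltr01.
  - by move=> t; rewrite in_itv /= => /andP[t0 t1]; apply: zd; apply: ltW.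
  - apply: derivable_within_continuous => t; rewrite in_itv /= => /andP[t0 t1].
    by have [] := zd t t0 t1.
  rewrite in_itv /= => /andP[t0 t1].
  have -> : z 1 = x by rewrite /z scale1r addrC subrK.
  have -> : z 0 = q by rewrite /z scale0r addr0.
  rewrite subr0 mulr1 => E.
  have [_ h _] := Hr _ (zr t (ltW t0) (ltW t1)).
  exact: coord_chord E (h _).
have [_ h1 h2] := Hr x xr.
have errle : `|err| <= 2 * e * `|x - q|.
  have -> : err = (f x - f q - 'd f y0 (x - q)) - (v - 'd f y0 (x - q)).
    by rewrite opprB [RHS]addrA subrK.
  by apply: le_trans (ler_normB _ _) _; have := h1 (x - q); lra.
exact: chord_split (h2 _) errle.
Unshelve. all: by end_near. Qed.

End AtPoint.
End Immersions.

(** * Second derivatives in normal directions *)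

Section SecondFundamentalForm.
Context {R : realType}.

(** The product rule at a zero of [h] needs only continuity of the other
    factor. *)
Lemma is_derive_mul_zero (q h : R -> R) (a : R) :
  {for 0, continuous q} -> is_derive (0 : R) (1 : R) h a -> h 0 = 0 ->
  is_derive (0 : R) (1 : R) (fun t => q t * h t) (q 0 * a).
Proof.
move=> qc [hd ha] h0.
have hcvg : (fun t : R => t^-1 *: (h (t *: (1 : R) + 0) - h 0)) @ 0^' --> a.
  by rewrite -ha; exact: hd.
have qcvg : q @ 0^' --> q 0 by exact: cvg_within_filter qc.
have E : (fun t : R => t^-1 *: (q (t *: (1 : R) + 0) * h (t *: (1 : R) + 0)
    - q 0 * h 0)) = (fun t : R => q t * (t^-1 *: (h (t *: (1 : R) + 0) - h 0))).
  apply/funext => t; rewrite h0 mulr0 !subr0 addr0 [t *: (1 : R)]mulr1.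
  by rewrite /GRing.scale /=; ring.
have c : (fun t : R => t^-1 *: (q (t *: (1 : R) + 0) * h (t *: (1 : R) + 0)
    - q 0 * h 0)) @ 0^' --> q 0 * a by rewrite E; exact: cvgM.
apply: DeriveDef; first by apply/cvg_ex; exists (q 0 * a).
by rewrite /derive; apply: cvg_lim.
Qed.

Lemma is_derive_unique (V W : normedModType R) (f : V -> W) x v a b :
  is_derive x v f a -> is_derive x v f b -> a = b.
Proof. by move=> [_ <-] [_ <-]. Qed.

Lemma near_line (V : normedModType R) (y w : V) (P : V -> Prop) :
  (\forall z \near y, P z) -> \forall t \near (0 : R), P (y + t *: w).
Proof.
move=> H.
have : (fun t : R => y + t *: w) @ (0 : R) --> y.
  rewrite -[X in _ --> X]addr0 -[X in _ --> _ + X](scale0r w).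
  by apply: cvgD; [exact: cvg_cst | apply: cvgZr_tmp; exact: cvg_id].
by move=> /(_ _ H).
Qed.

Lemma continuous_line (V W : normedModType R) (f : V -> W) (y w : V) :
  {for y, continuous f} -> {for 0, continuous (fun t : R => f (y + t *: w))}.
Proof.
move=> fc; rewrite /prop_for /continuous_at scale0r addr0 => P HP.
exact: (near_line w (fc P HP)).
Qed.

Variables (n m : nat) (f : 'rV[R]_n -> 'rV[R]_m) (y0 : 'rV[R]_n).
Hypothesis fdiff : \forall y \near y0, differentiable f y.
Hypothesis fdiff2 : forall v, differentiable ('D_v f) y0.
Hypothesis finj : injective ('d f y0).

Lemma derive_continuous v : {for y0, continuous ('D_v f)}.
Proof. exact: differentiable_continuous. Qed.

Variables (E : 'rV[R]_n -> 'rV[R]_m) (w : 'rV[R]_n -> 'rV[R]_n).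
Hypothesis Ediff : differentiable E y0.
Hypothesis Ew : \forall y \near y0, 'd f y (w y) = E y.

(** As 'd f is bounded below near [y0], it is enough that
    'd f y (w y - w y0) = E y - 'd f y (w y0) tends to 0. *)
Lemma tangent_coordinates_continuous : {for y0, continuous w}.
Proof.
have [c c0 Hc] := diff_bounded_below fdiff derive_continuous finj.
have Ec := differentiable_continuous Ediff.
have fc := @derive_continuous (w y0).
have fd0 := nbhs_singleton fdiff.
have Ew0 : E y0 = 'D_(w y0) f y0.
  by rewrite deriveE //; apply/esym; exact: nbhs_singleton Ew.
have lim0 : (fun y => E y - 'D_(w y0) f y) @ y0 --> (0 : 'rV[R]_m).
  rewrite -(subrr (E y0)) {2}Ew0.
  exact: (@cvgB _ _ _ (nbhs y0) (nbhs_filter y0) E ('D_(w y0) f)).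
apply/(@cvgrPdist_le _ _ _ (nbhs y0) (nbhs_filter y0)) => e e0.
move/cvgrPdist_le : lim0 => /(_ (c * e)); rewrite mulr_gt0 // => /(_ isT) lim0.
near=> y.
have h1 : `|0 - (E y - 'D_(w y0) f y)| <= c * e by near: y.
have h2 : forall v, c * `|v| <= `|'d f y v| by near: y.
have h3 : 'd f y (w y) = E y by near: y.
have fdy : differentiable f y by near: y.
have h4 : 'd f y (w y - w y0) = E y - 'D_(w y0) f y.
  by rewrite linearB h3 deriveE.
have := h2 (w y - w y0); rewrite h4 => h5.
rewrite distrC -(ler_pM2l c0); apply: le_trans h5 _.
by rewrite -normrN -sub0r.
Unshelve. all: by end_near. Qed.

(** Formally, differentiating E = 'd f (w) along w0 gives D^2 f(w0, w0) plus a
    tangent vector.  Here [w] is only known to be continuous; but the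
    functions h_i(t) = <xi, 'D_(e_i) f> along the line vanish at 0, so that the
    sum of the w_i h_i, which is <xi, E>, has a derivative at 0 nevertheless
    ([is_derive_mul_zero]). *)
Lemma normal_second_derivative xi w0 : w y0 = w0 ->
  (forall v, dot xi ('d f y0 v) = 0) ->
  dot xi ('d E y0 w0) = dot xi ('D_w0 ('D_w0 f) y0).
Proof.
move=> w0E xin.
pose e i : 'rV[R]_n := delta_mx 0 i.
pose h i t := dot xi ('D_(e i) f (y0 + t *: w0)).
have dotd (F : 'rV[R]_n -> 'rV[R]_m) : differentiable F y0 ->
    is_derive (0 : R) (1 : R) (fun t => dot xi (F (y0 + t *: w0)))
              (dot xi ('D_w0 F y0)).
  move=> Fd; have Fd' : differentiable F (y0 + 0 *: w0) by rewrite scale0r addr0.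
  have := is_derive_dot (is_derive_cst xi (0 : R) (1 : R)) (is_derive_line Fd').
  by rewrite dot0l add0r scale0r addr0.
have G1 := dotd _ Ediff.
have G2 : is_derive (0 : R) (1 : R)
    (fun t => \sum_i w (y0 + t *: w0) 0 i * h i t)
    (\sum_i w0 0 i * dot xi ('D_w0 ('D_(e i) f) y0)).
  have -> : (fun t => \sum_i w (y0 + t *: w0) 0 i * h i t) =
      \sum_i (fun t => w (y0 + t *: w0) 0 i * h i t).
    by apply/funext => t; rewrite fct_sumE.
  apply: is_derive_sum => i.
  have -> : w0 0 i = w (y0 + 0 *: w0) 0 i by rewrite scale0r addr0 w0E.
  apply: (is_derive_mul_zero (q := fun t => w (y0 + t *: w0) 0 i)).
  - apply: (continuous_line (f := fun y => w y 0 i)).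
    apply: (@continuous_comp _ _ _ w (fun u : 'rV[R]_n => u 0 i) y0).
      exact: tangent_coordinates_continuous.
    exact: coord_continuous.
  - exact: dotd.
  - rewrite /h scale0r addr0 deriveE ?xin //; exact: nbhs_singleton fdiff.
have G12 : \forall t \near (0 : R),
    \sum_i w (y0 + t *: w0) 0 i * h i t = dot xi (E (y0 + t *: w0)).
  apply: (near_line w0 (P := fun y =>
    \sum_i w y 0 i * dot xi ('D_(e i) f y) = dot xi (E y))).
  apply: filterS2 fdiff Ew => y fy <-.
  rewrite (diff_coord_sum _ fy) dot_sumr; apply: eq_bigr => i _.
  by rewrite dotZr.
have -> : dot xi ('d E y0 w0) = \sum_i w0 0 i * dot xi ('D_w0 ('D_(e i) f) y0).
  rewrite -deriveE //.
  exact: (is_derive_unique G1 (near_eq_is_derive G12 G2)).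
have near_sum : \forall y \near y0,
    (\sum_i (w0 0 i *: ('D_(e i) f))) y = 'D_w0 f y.
  apply: filterS fdiff => y fy.
  rewrite (deriveE _ fy) fct_sumE; exact/esym/diff_coord_sum.
have D2 : is_derive y0 w0 (\sum_i (w0 0 i *: ('D_(e i) f)))
    (\sum_i w0 0 i *: 'D_w0 ('D_(e i) f) y0).
  apply: is_derive_sum => i; apply: is_deriveZ; apply: derivableP.
  exact: diff_derivable.
rewrite (@derive_val _ _ _ _ _ _ _ (near_eq_is_derive near_sum D2)).
by rewrite dot_sumr; apply: eq_bigr => i _; rewrite dotZr.
Qed.

End SecondFundamentalForm.

(** * Tangent spaces and frames of an immersion *)

Section ImmersedManifold.
Context {R : realType} {n m : nat} {M : topologicalType}.
Variables (A : set (chart R n M)) (X : M -> 'rV[R]_m).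
Hypotheses (hM : smooth_manifold A) (hX : immersion A X).

Let T := tangent_space A X.

Lemma chart_at p : exists2 c, A c & chart_dom c p.
Proof. by have [_ _ + _] := hM; apply. Qed.

Lemma immersion_twice_differentiable c y : A c -> chart_cod c y ->
  differentiable (X \o chart_inv c) y /\
  forall v, differentiable ('D_v (X \o chart_inv c)) y.
Proof.
move=> Ac cy; have [/(_ c Ac 2%N) [h1 h2] _] := hX.
have cy' : (chart_cod c `&` chart_inv c @^-1` [set: M]) y by split.
split; first exact: h1.
by move=> v; have [h _] := h2 v; exact: h.
Qed.

Lemma near_chart_cod (c : chart R n M) y :
  chart_cod c y -> \forall z \near y, chart_cod c z.
Proof. by move=> cy; exact: (open_nbhs_nbhs (conj (@chart_cod_open _ _ _ c) cy)). Qed.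

Lemma near_chart_inv (c : chart R n M) p (P : M -> Prop) : chart_dom c p ->
  (\forall q \near p, P q) -> \forall y \near chart_map c p, P (chart_inv c y).
Proof.
move=> cp Pp; have := chart_inv_continuous (chart_map_cod cp).
by rewrite /prop_for /continuous_at chart_mapK // => /(_ _ Pp).
Qed.

(** Chain rule for the transition map. *)
Lemma diff_chart_change c d p w : A c -> A d -> chart_dom c p -> chart_dom d p ->
  exists w', 'd (X \o chart_inv d) (chart_map d p) w' =
             'd (X \o chart_inv c) (chart_map c p) w.
Proof.
move=> Ac Ad cp dp; set y := chart_map c p.
have cy : chart_cod c y := chart_map_cod cp.
have cyp : chart_inv c y = p := chart_mapK cp.
pose S := chart_map d \o chart_inv c.
have Sd : differentiable S y.
  have [_ _ _ /(_ c d Ac Ad 1%N) [h _]] := hM; apply: h; split => //.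
  by rewrite /= cyp.
have Sy : S y = chart_map d p by rewrite /S /= cyp.
have [fd _] := immersion_twice_differentiable Ac cy.
have [gd _] := immersion_twice_differentiable Ad (chart_map_cod dp).
rewrite -Sy in gd *.
have E : \forall z \near y, ((X \o chart_inv d) \o S) z = (X \o chart_inv c) z.
  have := near_chart_inv cp (open_nbhs_nbhs (conj (@chart_dom_open _ _ _ d) dp)).
  by apply: filterS => z dz; rewrite /S /= chart_mapK.
exists ('d S y w).
have e1 := deriveE w (differentiable_comp Sd gd).
have e2 := congr1 (fun F => F w) (diff_comp Sd gd).
have e3 := near_eq_derive w E.
have e4 := deriveE w fd.
have e5 := etrans (esym e1) (etrans e3 e4).
refine (etrans _ e5).
exact (esym e2).
Qed.

(** [tangent_space] is a union over all charts; each of them already gives all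
    of it. *)
Lemma tangent_in_chart c p v : A c -> chart_dom c p -> T p v ->
  exists w, 'd (X \o chart_inv c) (chart_map c p) w = v.
Proof.
move=> Ac cp [d [w [Ad dp <-]]]; exact: diff_chart_change.
Qed.

(** The [E i] come from [n] vectors of R^n.  If [W] and [J] are the matrices of
    these vectors and of the differential, orthonormality says that [W *m J]
    has a right inverse; so [W] is invertible and its rows span R^n. *)
Lemma tangent_span (E : 'I_n -> 'rV[R]_m) p v :
  (forall i, T p (E i)) -> (forall i j, dot (E i) (E j) = (i == j)%:R) ->
  T p v <-> exists a : 'I_n -> R, v = \sum_i a i *: E i.
Proof.
move=> ET orthoE; have [c Ac cp] := chart_at p.
set y := chart_map c p; set df := 'd (X \o chart_inv c) y.
have [e He] : exists e, forall i, df (e i) = E i.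
  have H i := tangent_in_chart Ac cp (ET i).
  by exists (fun i => sval (cid (H i))) => i; case: cid.
split=> [Tv|[a ->]]; last first.
  exists c, (\sum_i a i *: e i); split => //.
  by rewrite linear_sum; apply: eq_bigr => i _; rewrite linearZ He.
have [w <-] := tangent_in_chart Ac cp Tv.
pose W : 'M[R]_n := \matrix_i e i.
pose F : 'M[R]_(n, m) := \matrix_i E i.
pose J := lin1_mx df.
have WJ : W *m J = F.
  by apply/row_matrixP => i; rewrite row_mul !rowK mul_rV_lin1.
have FF : F *m F^T = 1%:M.
  apply/matrixP => i j; rewrite !mxE -orthoE; apply: eq_bigr => l _.
  by rewrite !mxE.
have [G WG] : exists G, W *m G = 1%:M by exists (J *m F^T); rewrite mulmxA WJ.
exists (fun i => (w *m G) 0 i).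
rewrite -[LHS](mul_rV_lin1 df) -/J.
transitivity ((w *m G) *m F).
  by rewrite -WJ mulmxA -(mulmxA w) (mulmx1C WG) mulmx1.
rewrite mulmx_sum_row; apply: eq_bigr => i _; by rewrite rowK.
Qed.

Lemma nabla_in_chart p v (Y : M -> 'rV[R]_m) : T p v ->
  exists c w, [/\ A c, chart_dom c p,
     'd (X \o chart_inv c) (chart_map c p) w = v &
     nabla A X p v Y = 'd (Y \o chart_inv c) (chart_map c p) w].
Proof.
move=> [c [w [Ac cp cw]]].
exact: (@getPex _ [set z | exists c w, [/\ A c, chart_dom c p,
     'd (X \o chart_inv c) (chart_map c p) w = v &
     z = 'd (Y \o chart_inv c) (chart_map c p) w]]
   (ex_intro _ _ (ex_intro _ c (ex_intro _ w (And4 Ac cp cw erefl))))).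
Qed.

(** The orthonormal frame provides the orthogonal projection to the tangent
    space, and so ensures that the chosen [normal_component] is one. *)
Lemma dot_normal_part (E : 'I_n -> 'rV[R]_m) p xi z :
  (forall i, T p (E i)) -> (forall i j, dot (E i) (E j) = (i == j)%:R) ->
  (forall v, T p v -> dot xi v = 0) ->
  dot xi (normal_part A X p z) = dot xi z.
Proof.
move=> ET orthoE xiT.
pose t := \sum_i dot z (E i) *: E i.
have Tt : T p t by apply/(tangent_span _ ET orthoE); exists (fun i => dot z (E i)).
have [_ ] : [set w | orthogonal_complement (T p) w /\ T p (z - w)]
    (normal_part A X p z).
  apply: getPex; exists (z - t); split; last by rewrite subKr.
  move=> v /(tangent_span _ ET orthoE) [a ->].
  rewrite dot_span big1 // => i _.
  by rewrite dotBl dot_orthonormal_suml // subrr mulr0.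
by move=> /xiT; rewrite dotBr => /subr0_eq ->.
Qed.

End ImmersedManifold.

(** * The minimum principle on a self-shrinker *)

Section MinimumPrinciple.
Context {R : realType} {n m : nat} {M : topologicalType}.
Variables (A : set (chart R n M)) (X : M -> 'rV[R]_m).
Hypotheses (hM : smooth_manifold A) (hX : immersion A X).

Let T := tangent_space A X.

Section LocalMinimum.
Variables (k : nat) (a : 'rV[R]_m) (g dg : R -> R) (d2g : R) (p : M).
Let s := dot (X p - a) (X p - a).
Let xi := front k (X p) + dg s *: (X p - a).
Hypothesis g_derive : forall r, is_derive r (1 : R) g (dg r).
Hypothesis dg_derive : is_derive s (1 : R) dg d2g.
Hypothesis local_min : \forall q \near p,
  dot (front k (X p)) (front k (X p)) + g s <=
  dot (front k (X q)) (front k (X q)) + g (dot (X q - a) (X q - a)).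

Lemma chart_line_min_test c w (f := X \o chart_inv c) (y := chart_map c p) :
  A c -> chart_dom c p ->
  dot xi ('d f y w) = 0 /\
  0 <= dot (front k ('d f y w)) (front k ('d f y w))
       + dg s * dot ('d f y w) ('d f y w)
       + 2 * d2g * dot (X p - a) ('d f y w) ^+ 2
       + dot xi ('D_w ('D_w f) y).
Proof.
move=> Ac cp; have cy : chart_cod c y := chart_map_cod cp.
have [fd fd2] := immersion_twice_differentiable hX Ac cy.
have y0E : y + 0 *: w = y by rewrite scale0r addr0.
have fy : X (chart_inv c (y + 0 *: w)) = X p by rewrite y0E chart_mapK.
have D : 'D_w f (y + 0 *: w) = 'd f y w by rewrite y0E; exact: deriveE.
have cod_line : \forall t \near (0 : R), chart_cod c (y + t *: w).
  exact: (near_line (V := 'rV[R]_n) w (near_chart_cod cy)).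
have H1 : \forall t \near (0 : R), is_derive t (1 : R)
    (fun t => f (y + t *: w)) ('D_w f (y + t *: w)).
  apply: filterS cod_line => t ct; apply: is_derive_line.
  by have [] := immersion_twice_differentiable hX Ac ct.
have H2 : is_derive (0 : R) (1 : R) (fun t => 'D_w f (y + t *: w))
    ('D_w ('D_w f) y).
  have fd2' : differentiable ('D_w f) (y + 0 *: w) by rewrite y0E.
  by have := is_derive_line fd2'; rewrite y0E.
have H3 := near_line (V := 'rV[R]_n) w (near_chart_inv cp local_min).
exact (curve_min_test (x := fun t => f (y + t *: w))
  (dx := fun t => 'D_w f (y + t *: w)) fy D H1 H2 g_derive dg_derive H3).
Qed.

Lemma gradient_normal v : T p v -> dot xi v = 0.
Proof.
by move=> [c [w [Ac cp <-]]]; have [] := chart_line_min_test w Ac cp.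
Qed.

(** The acceleration of the line in direction w, with dX(w) = Y p, may be
    replaced by nabla_Y Y, since [xi] is normal. *)
Lemma tangent_field_min_test U (Y : M -> 'rV[R]_m) :
  open U -> U p -> smooth_map A U Y -> (forall q, U q -> T q (Y q)) ->
  0 <= dot (front k (Y p)) (front k (Y p)) + dg s * dot (Y p) (Y p)
       + 2 * d2g * dot (X p - a) (Y p) ^+ 2 + dot xi (nabla A X p (Y p) Y).
Proof.
move=> Uo Up Ysm YT.
have [c [w [Ac cp dw ->]]] := nabla_in_chart Y (YT p Up).
have [_ min_w] := chart_line_min_test w Ac cp.
set y := chart_map c p in dw min_w *; set f := X \o chart_inv c in dw min_w *.
have cy : chart_cod c y := chart_map_cod cp.
have [fd fd2] := immersion_twice_differentiable hX Ac cy.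
have finj : injective ('d f y) by have [_] := hX; apply.
have fdiff : \forall z \near y, differentiable f z.
  apply: filterS (near_chart_cod cy) => z cz.
  by have [] := immersion_twice_differentiable hX Ac cz.
(* The coordinates of the field [Y] in the chart. *)
pose W z := get [set v | 'd f z v = Y (chart_inv c z)].
have WY : \forall z \near y, 'd f z (W z) = (Y \o chart_inv c) z.
  have nU := near_chart_inv cp (open_nbhs_nbhs (conj Uo Up)).
  apply: filterS2 (near_chart_cod cy) nU => z cz Uz.
  have [v hv] := tangent_in_chart hM hX Ac (chart_inv_dom cz) (YT _ Uz).
  have := @getPex _ [set v | 'd f z v = Y (chart_inv c z)].
  by rewrite (chart_invK cz) in hv; apply; exists v.
have Yd : differentiable (Y \o chart_inv c) y.
  have [h _] := Ysm c Ac 1%N; apply: h; split => //=.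
  by rewrite chart_mapK.
have Wy : W y = w.
  apply: finj; rewrite dw (nbhs_singleton WY) /= chart_mapK //.
have xin v : dot xi ('d f y v) = 0 by apply: gradient_normal; exists c, v.
have key := normal_second_derivative fdiff fd2 finj Yd WY Wy xin.
have transfer (v v' : 'rV[R]_m) (d d' : R) (F : 'rV[R]_m -> R) :
  v = v' -> d' = d -> 0 <= F v + d -> 0 <= F v' + d' by move=> -> ->.
exact (transfer _ _ _ _ (fun v => dot (front k v) (front k v)
  + dg s * dot v v + 2 * d2g * dot (X p - a) v ^+ 2) dw key min_w).
Qed.

End LocalMinimum.

(** The previous test, summed over an orthonormal frame [E].  The accelerations
    add up to <xi, H> = - <xi, X>/2 by the shrinker equation, and the normality
    of [xi] turns the sum of the <front X, E_i>^2 given by [front_trace_le] into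
    dg^2 tau, where tau is the squared length of the tangential part of X - a. *)
Lemma shrinker_min_test k a (g dg : R -> R) (d2g : R) p
    (s := dot (X p - a) (X p - a)) (u := dot (front k (X p)) (front k (X p))) :
  (k < m)%N -> self_shrinker A X -> 0 < u ->
  (forall r, is_derive r (1 : R) g (dg r)) -> is_derive s (1 : R) dg d2g ->
  (\forall q \near p, u + g s <=
    dot (front k (X q)) (front k (X q)) + g (dot (X q - a) (X q - a))) ->
  exists tau : R, [/\ 0 <= tau <= s,
    forall v, T p v -> dot (X p - a) v ^+ 2 <= dot v v * tau &
    0 <= 2 * k%:R - u + (2 * dg s ^+ 2 / u + 4 * d2g) * tau
         + dg s * (2 * n%:R - dot (X p - a) (X p))].
Proof.
move=> km shr u0 hg hdg hmin.
have [U [E [Uo Up [Esm ET Eo] HE]]] := shr p.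
have ETp i : T p (E i p) := ET p i Up.
have Eop i j : dot (E i p) (E j p) = (i == j)%:R := Eo p i j Up.
pose xi := front k (X p) + dg s *: (X p - a).
have xiE v : dot xi v = dot (front k (X p)) v + dg s * dot (X p - a) v.
  by rewrite [LHS]dotDl dotZl.
have xiN v : T p v -> dot xi v = 0 := gradient_normal hg hdg hmin (v := v).
exists (\sum_i dot (X p - a) (E i p) ^+ 2); set tau := \sum_i _; split.
- by rewrite sumr_ge0 ?bessel // => i _; exact: sqr_ge0.
- move=> v /(tangent_span hM hX _ ETp Eop) [b ->].
  exact: sqr_dot_span_le.
have xiH : dot xi (\sum_i normal_part A X p (nabla A X p (E i p) (E i))) =
    - (u + dg s * dot (X p - a) (X p)) / 2.
  rewrite -HE dotZr (dot_normal_part hM hX _ ETp Eop xiN) xiE -dot_front_front -/u.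
  by field.
have step : 0 <= \sum_i (dot (front k (E i p)) (front k (E i p)) + dg s
    + 2 * d2g * dot (X p - a) (E i p) ^+ 2
    + dot xi (normal_part A X p (nabla A X p (E i p) (E i)))).
  apply: sumr_ge0 => i _; rewrite (dot_normal_part hM hX _ ETp Eop xiN).
  have := tangent_field_min_test hg hdg hmin Uo Up (Esm i) (fun q Uq => ET q i Uq).
  by rewrite Eop eqxx mulr1.
have tr := front_trace_le km Eop u0.
have grad : \sum_i dot (front k (X p)) (E i p) ^+ 2 = dg s ^+ 2 * tau.
  rewrite mulr_sumr; apply: eq_bigr => i _.
  by have /eqP := xiN _ (ETp i); rewrite xiE addr_eq0 => /eqP ->; ring.
rewrite grad -/u in tr.
move: step; rewrite !big_split /= -dot_sumr xiH -mulr_sumr -/tau.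
rewrite sumr_const card_ord -[dg s *+ n]mulr_natr => step.
have -> : 2 * dg s ^+ 2 / u = 2 * (dg s ^+ 2 / u) by rewrite mulrA.
have e : dg s ^+ 2 * tau / u = dg s ^+ 2 / u * tau by rewrite mulrAC.
rewrite e in tr; lra.
Qed.

End MinimumPrinciple.

(** * Continuity and compactness in R^m *)

Section Continuity.
Context {R : realType} {m : nat}.

Lemma continuous_sum_coord (P : pred 'I_m) (a : 'rV[R]_m) :
  continuous (fun v : 'rV[R]_m => \sum_(j < m | P j) (v - a) 0 j * (v - a) 0 j).
Proof.
apply: continuous_big => [|j _]; first exact: add_continuous.
move=> v.
have c : {for v, continuous (fun v : 'rV[R]_m => (v - a) 0 j)}.
  have -> : (fun v : 'rV[R]_m => (v - a) 0 j) = (fun v => v 0 j - a 0 j).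
    by apply/funext => z; rewrite !mxE.
  by apply: continuousB; [exact: coord_continuous | exact: cst_continuous].
exact: continuousM.
Qed.

Lemma continuous_dist2 (a : 'rV[R]_m) :
  continuous (fun v : 'rV[R]_m => dot (v - a) (v - a)).
Proof. exact: continuous_sum_coord. Qed.

Lemma continuous_norm2 : continuous (fun v : 'rV[R]_m => dot v v).
Proof.
have := @continuous_dist2 0.
by rewrite (_ : (fun v => _) = (fun v : 'rV[R]_m => dot v v)) //;
  apply/funext => v; rewrite subr0.
Qed.

Lemma continuous_front2 k :
  continuous (fun v : 'rV[R]_m => dot (front k v) (front k v)).
Proof.
rewrite (_ : (fun v => _) = (fun v : 'rV[R]_m =>
    \sum_(j < m | (j <= k)%N) (v - 0) 0 j * (v - 0) 0 j)).
  exact: continuous_sum_coord.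
by apply/funext => v; rewrite dot_front_front dot_front subr0.
Qed.

Lemma compact_norm2_le (B : R) : compact [set v : 'rV[R]_m | dot v v <= B].
Proof.
apply: bounded_closed_compact; last first.
  apply: (@closed_comp _ _ (fun v : 'rV[R]_m => dot v v) [set x | x <= B]).
    by move=> v _; exact: continuous_norm2.
  exact: closed_le.
exists (Num.sqrt B); split; first exact: num_real.
move=> r Br v /= vB; apply: le_trans (ltW Br).
rewrite -(ger0_norm (normr_ge0 v)) -sqrtr_sqr ler_wsqrtr //.
by apply: le_trans vB; exact: sqr_norm_le_dot.
Qed.

End Continuity.

(** * The contact set is open and closed *)

(* The factor [b] makes the derivative of a barrier a barrier, so that the same
   lemma gives the second derivative. *)
Lemma is_derive_exp_barrier (R : realType) (b al r : R) :
  is_derive r (1 : R) (fun s => b * expR (- al * s))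
    (- al * b * expR (- al * r)).
Proof.
have h1 : is_derive r (1 : R) (fun s : R => - al * s) (- al).
  apply: (is_derive_eq (is_deriveZ (- al) (is_derive_id r (1 : R)))).
  exact: mulr1.
have h2 := is_derive1_comp (is_derive_expR (- al * r)) h1.
apply: (is_derive_eq (is_deriveZ b h2)).
by rewrite /GRing.scale /=; ring.
Qed.

(** For g(s) = - delta exp(- al s), the term in [tau] of [shrinker_min_test] is
    at most - 3 al^2 delta E tau, since 2/u <= 1 and delta E <= 1; it beats the
    first order term al delta E D as soon as 3 al tau > D. *)
Lemma barrier_algebra (R : realType) (b u al delta E tau rin C D : R) :
  2 <= u -> b <= u -> 0 < al -> 0 < delta -> delta <= 1 ->
  0 < E -> E <= 1 -> 0 < rin -> rin < 9 * tau -> al * rin = 3 * C ->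
  0 < C -> D < C ->
  ~ 0 <= b - u + (2 * (al * delta * E) ^+ 2 / u - 4 * al ^+ 2 * delta * E) * tau
         + al * delta * E * D.
Proof.
move=> u2 bu al0 d0 d1 E0 E1 rin0 rt alr C0 DC.
have tau0 : 0 < tau by lra.
have u0 : 0 < u by lra.
have h1 : 2 * (al * delta * E) ^+ 2 / u <= (al * delta * E) ^+ 2.
  rewrite ler_pdivrMr // mulrC ler_wpM2l // exprn_ge0 //.
  by rewrite !mulr_ge0 // ltW.
have h2 : (al * delta * E) ^+ 2 <= al ^+ 2 * delta * E.
  have -> : (al * delta * E) ^+ 2 = (al ^+ 2 * delta * E) * (delta * E) by ring.
  rewrite ler_piMr ?mulr_ile1 // ?ltW // !mulr_gt0 // exprn_gt0 //.
have p0 : 0 < al * delta * E by rewrite !mulr_gt0.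
have h3 : (2 * (al * delta * E) ^+ 2 / u - 4 * al ^+ 2 * delta * E) * tau <=
    - 3 * (al ^+ 2 * delta * E) * tau.
  by rewrite ler_wpM2r ?(ltW tau0) //; lra.
have h4 : al * rin < al * (9 * tau) by rewrite ltr_pM2l.
have h5 : al * delta * E * (D - 3 * (al * tau)) < 0.
  by rewrite pmulr_rlt0 //; lra.
apply/negP; rewrite -ltNge.
have h6 : - 3 * (al ^+ 2 * delta * E) * tau =
    al * delta * E * (- 3 * (al * tau)) by ring.
by lra.
Qed.

Section Shrinker.
Context {R : realType} {n m : nat} {M : topologicalType}.
Variables (A : set (chart R n M)) (X : M -> 'rV[R]_m) (k : nat).
Hypotheses (hM : smooth_manifold A) (hX : immersion A X) (km : (k < m)%N)
  (k0 : (0 < k)%N) (hshr : self_shrinker A X).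

Let u p := dot (front k (X p)) (front k (X p)).
Hypothesis u_ge : forall p, 2 * k%:R <= u p.

Let u_ge2 p : 2 <= u p.
Proof.
apply: le_trans (u_ge p); have : 1 <= k%:R :> R by rewrite ler1n.
by lra.
Qed.

(** Suppose that u(q) > 2k for some [q] close to the contact point [y0], and
    minimize F = u - delta exp(- al |f - f q|^2) over the chart ball.  As
    u >= 2k with equality at [y0], the minimum cannot lie on the boundary of the
    ball, where the distance to f q exceeds that of f y0; nor close to q, where
    u - 2k is at least delta.  At an interior minimum away from q the barrier is
    strictly subharmonic for large [al], which contradicts
    [shrinker_min_test]. *)
Lemma hopf_barrier (c : chart R n M) (y0 q : 'rV[R]_n) (rho c0 K : R)
    (f := X \o chart_inv c) :
  A c -> 0 < rho -> 0 < c0 ->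
  (forall x, `|x - y0| <= rho -> chart_cod c x) ->
  (forall x z, `|x - y0| <= rho -> `|z - y0| <= rho ->
    let v := 'd f x (x - z) in let e := f x - f z - v in
    4 * dot e e <= dot v v /\ c0 * `|x - z| ^+ 2 <= dot (f x - f z) (f x - f z)) ->
  (forall x, `|x - y0| <= rho -> dot (f x) (f x) <= K) ->
  `|q - y0| <= rho / 2 ->
  4 * dot (f y0 - f q) (f y0 - f q) < c0 * rho ^+ 2 ->
  u (chart_inv c y0) = 2 * k%:R -> u (chart_inv c q) = 2 * k%:R.
Proof.
move=> Ac rho0 c00 Ncod chord fK qy0 far uy0.
apply/eqP; rewrite eq_le u_ge andbT leNgt; apply/negP => uq.
have qN : `|q - y0| <= rho by apply: le_trans qy0 _; lra.
have y0N : `|y0 - y0| <= rho by rewrite subrr normr0 ltW.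
have K0 : 0 <= K := le_trans (dot_ge0 _) (fK y0 y0N).
have fcont x : `|x - y0| <= rho -> {for x, continuous f}.
  move=> /Ncod cx; apply: differentiable_continuous.
  by have [] := immersion_twice_differentiable hX Ac cx.
pose U x := u (chart_inv c x).
have Ucont x : `|x - y0| <= rho -> {for x, continuous U}.
  move=> xN; apply: (@continuous_comp _ _ _ f
    (fun v => dot (front k v) (front k v)) x (fcont x xN)).
  exact: continuous_front2.
pose eta := (U q - 2 * k%:R) / 2.
have eta0 : 0 < eta by rewrite divr_gt0 // subr_gt0.
have [e e0 He] : exists2 e : R, 0 < e &
    forall x, `|x - q| < e -> 2 * k%:R + eta <= U x.
  have /cvgrPdist_lt/(_ _ eta0)/nbhs_ballP[e /= e0 He] := Ucont q qN.
  exists e => // x xq; have : `|U q - U x| < eta.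
    by apply: He; rewrite -ball_normE /= distrC.
  by rewrite ltr_norml /eta => /andP[]; lra.
pose a := f q.
pose S x := dot (f x - a) (f x - a).
have chordS x : `|x - y0| <= rho -> c0 * `|x - q| ^+ 2 <= S x.
  by move=> xN; have [] := chord x q xN qN.
(* By [chordS], points at squared distance at most [rin] of f q come from the
   ball of radius [e] about q. *)
pose rin := c0 * e ^+ 2 / 4.
have rin0 : 0 < rin by rewrite divr_gt0 // mulr_gt0 // exprn_gt0.
pose al := 3 * (2 * n%:R + K + 1) / rin.
have C0 : 0 < 2 * n%:R + K + 1 by rewrite ltr_wpDl // addr_ge0 // mulr_ge0.
have al0 : 0 < al by rewrite divr_gt0 // mulr_gt0.
pose delta := Num.min 1 eta.
have delta0 : 0 < delta by rewrite lt_min ltr01.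
have delta1 : delta <= 1 by rewrite ge_min lexx.
have deltaeta : delta <= eta by rewrite ge_min lexx orbT.
pose g s := - delta * expR (- al * s).
pose N := [set x : 'rV[R]_n | `|x - y0| <= rho].
have Ncompact : compact N.
  apply: bounded_closed_compact.
    exists (rho + `|y0|); split; first exact: num_real.
    move=> r hr x /= xN; apply: le_trans (ltW hr).
    by rewrite -{1}[x](subrK y0) (le_trans (ler_normD _ _)) // lerD2r.
  apply: (@closed_comp _ _ (fun x : 'rV[R]_n => `|x - y0|) [set t | t <= rho]).
    move=> x _; apply: (@continuous_comp _ _ _ (fun x : 'rV[R]_n => x - y0) Num.norm).
      by apply: continuousB; [exact: cvg_id | exact: cst_continuous].
    exact: norm_continuous.
  exact: closed_le.
have Fcont : {within N, continuous (fun x => U x + g (S x))}.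
  apply: continuous_in_subspaceT => x /set_mem xN.
  apply: continuousD; first exact: Ucont.
  apply: (@continuous_comp _ _ _ S g).
    apply: (@continuous_comp _ _ _ f (fun v => dot (v - a) (v - a))).
      exact: fcont.
    exact: continuous_dist2.
  apply: differentiable_continuous; apply/derivable1_diffP.
  by have [] := is_derive_exp_barrier (- delta) al (S x).
have [x xN xmin] := compact_EVT_min (ex_intro _ y0 y0N) Ncompact Fcont.
have {}xN := set_mem xN.
have {}xmin z : `|z - y0| <= rho -> U x + g (S x) <= U z + g (S z).
  by move=> zN; apply: xmin; apply/mem_set.
have xy0 := xmin y0 y0N.
have Ux : 2 * k%:R <= U x := u_ge _.
have Uy0 : U y0 = 2 * k%:R := uy0.
have xint : `|x - y0| < rho.
  rewrite ltNge; apply/negP => xbd.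
  have xq : rho / 2 <= `|x - q|.
    by have := ler_normD (x - q) (q - y0); rewrite addrA subrK; lra.
  have h1 : c0 * (rho / 2) ^+ 2 <= S x.
    apply: le_trans (chordS x xN); rewrite ler_pM2l //.
    by rewrite ler_pXn2r ?nnegrE // divr_ge0 // ltW.
  have h2 : S y0 < S x by apply: lt_le_trans h1; rewrite /S /a expr_div_n; lra.
  have : g (S y0) < g (S x).
    by rewrite /g !mulNr ltrN2 ltr_pM2l // ltr_expR ltrN2 ltr_pM2l.
  by move: xy0; rewrite Uy0; lra.
have xfar : rin < S x.
  rewrite ltNge; apply/negP => xnear.
  have xq : `|x - q| < e.
    rewrite ltNge; apply/negP => h.
    have h1 : e ^+ 2 <= `|x - q| ^+ 2 by rewrite ler_pXn2r ?nnegrE // ltW.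
    have h2 : c0 * e ^+ 2 <= rin.
      by apply: le_trans xnear; apply: le_trans (chordS x xN); rewrite ler_pM2l.
    have h3 : 0 < c0 * e ^+ 2 by rewrite mulr_gt0 // exprn_gt0.
    by move: h2; rewrite /rin; lra.
  have h1 := He x xq.
  have h2 : - delta <= g (S x).
    rewrite /g mulNr lerN2; apply: ler_piMr; first exact: ltW.
    by rewrite expR_le1 mulNr oppr_le0 mulr_ge0 ?dot_ge0 // ltW.
  have h3 : g (S y0) < 0 by rewrite /g mulNr oppr_lt0 mulr_gt0 // expR_gt0.
  by move: xy0; rewrite Uy0; lra.
have cx := Ncod x xN; set p := chart_inv c x.
have cp : chart_dom c p := chart_inv_dom cx.
have px : chart_map c p = x := chart_invK cx.
have near_x : \forall z \near x, U x + g (S x) <= U z + g (S z).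
  apply/nbhs_ballP; exists (rho - `|x - y0|); first by rewrite /= subr_gt0.
  move=> z; rewrite -ball_normE /= => xz; apply: xmin.
  have := ler_normD (z - x) (x - y0); rewrite addrA subrK (distrC z x); lra.
have near_p : \forall z \near p, u p + g (dot (X p - a) (X p - a)) <=
    u z + g (dot (X z - a) (X z - a)).
  have hc := chart_map_continuous cp; rewrite /prop_for /continuous_at px in hc.
  have h1 : \forall z \near p, U x + g (S x) <=
      U (chart_map c z) + g (S (chart_map c z)) := hc _ near_x.
  have h2 := open_nbhs_nbhs (conj (@chart_dom_open _ _ _ c) cp).
  by apply: filterS2 h1 h2 => z hz cz; move: hz; rewrite /U /S /f /= chart_mapK.
have up0 : 0 < u p by apply: lt_le_trans (u_ge2 p).
have [tau [/andP[tau0 _] tauT ineq]] := shrinker_min_test hM hX km hshr up0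
  (is_derive_exp_barrier (- delta) al) (is_derive_exp_barrier (- al * - delta) al _)
  near_p.
have [ch _] := chord x q xN qN.
have tv : dot (X p - a) ('d f x (x - q)) ^+ 2 <=
    dot ('d f x (x - q)) ('d f x (x - q)) * tau.
  apply: tauT; exists c, (x - q).
  by split; [| |exact: (congr1 (fun z => 'd f z (x - q)) px)].
have Stau := chord_tangent tau0 ch tv.
(* - <X - a, X> <= |a|^2/4 <= K, on completing the square. *)
have D2n : 2 * n%:R - dot (X p - a) (X p) < 2 * n%:R + K + 1.
  have aK : dot a a <= K := fK q qN.
  have := dot_ge0 (X p - a); rewrite !(dotBl, dotBr) (dotC (X p) a).
  have := dot_ge0 (X p).
  have := dot_ge0 a; lra.
move: (Stau) (xfar); rewrite -/(S x) => St xf.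
have E1 : expR (- al * S x) <= 1.
  by rewrite expR_le1 mulNr oppr_le0 mulr_ge0 ?dot_ge0 // ltW.
have alr : al * rin = 3 * (2 * n%:R + K + 1) by rewrite divfK // gt_eqF.
apply: (barrier_algebra (u_ge2 p) (u_ge p) al0 delta0 delta1 (expR_gt0 _) E1
  rin0 (lt_le_trans xf St) alr C0 D2n).
move: ineq; rewrite -/(u p) -[dot (X p - a) (X p - a)]/(S x) mulrNN.
have -> : 4 * (- al * (al * delta) * expR (- al * S x)) =
  - (4 * al ^+ 2 * delta * expR (- al * S x)) by ring.
by [].
Qed.

Lemma contact_set_open p0 : u p0 = 2 * k%:R -> \forall q \near p0, u q = 2 * k%:R.
Proof.
move=> up0; have [c Ac cp] := chart_at hM p0.
set y0 := chart_map c p0; pose f := X \o chart_inv c.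
have cy : chart_cod c y0 := chart_map_cod cp.
have cyp : chart_inv c y0 = p0 := chart_mapK cp.
have [fd fd2] := immersion_twice_differentiable hX Ac cy.
have finj : injective ('d f y0) by have [_] := hX; apply.
have fdiff : \forall z \near y0, differentiable f z.
  apply: filterS (near_chart_cod cy) => z cz.
  by have [] := immersion_twice_differentiable hX Ac cz.
have [rho [c0 [rho0 c00 chord]]] := chord_estimate fdiff (derive_continuous fd2) finj.
have fcont : {for y0, continuous f} by exact: differentiable_continuous.
pose K := dot (f y0) (f y0) + 1.
have nearK : \forall z \near y0, dot (f z) (f z) <= K.
  have h : {for y0, continuous (fun z => dot (f z) (f z))}.
    apply: (@continuous_comp _ _ _ f (fun v => dot v v)) => //.
    exact: continuous_norm2.
  have /cvgrPdist_le/(_ _ ltr01) := h; apply: filterS => z.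
  by rewrite ler_norml /K => /andP[]; lra.
have /nbhs_ballP[r /= r0 Hr] : \forall z \near y0,
    chart_cod c z /\ dot (f z) (f z) <= K.
  by apply: filterI nearK; exact: near_chart_cod.
pose rho1 := Num.min rho (r / 2).
have rho10 : 0 < rho1 by rewrite lt_min rho0 divr_gt0.
have rho1r z : `|z - y0| <= rho1 -> `|z - y0| <= rho /\ ball y0 r z.
  move=> zr; split; first by apply: le_trans zr _; rewrite ge_min lexx.
  rewrite -ball_normE /= distrC; apply: le_lt_trans zr _.
  by rewrite gt_min; apply/orP; right; lra.
have claim : \forall q \near y0, u (chart_inv c q) = 2 * k%:R.
  have h1 : \forall q \near y0, `|q - y0| <= rho1 / 2.
    have d0 : 0 < rho1 / 2 by rewrite divr_gt0.
    by apply: filterS (nbhsx_ballx y0 _ d0) => q; rewrite -ball_normE /= distrC => /ltW.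
  have h2 : \forall q \near y0, 4 * dot (f y0 - f q) (f y0 - f q) < c0 * rho1 ^+ 2.
    have h : {for y0, continuous (fun q => dot (f q - f y0) (f q - f y0))}.
      apply: (@continuous_comp _ _ _ f (fun v => dot (v - f y0) (v - f y0))) => //.
      exact: continuous_dist2.
    have d0 : 0 < c0 * rho1 ^+ 2 / 4 by rewrite divr_gt0 // mulr_gt0 // exprn_gt0.
    have /cvgrPdist_lt/(_ _ d0) := h; apply: filterS => q.
    rewrite subrr dot0l sub0r normrN => /ltr_normlP[_].
    by rewrite -(opprB (f q)) dotNl dotNr opprK; lra.
  apply: filterS2 h1 h2 => q h1 h2.
  apply: (hopf_barrier (K := K) Ac rho10 c00 _ _ _ h1 h2).
  - by move=> x /rho1r[_ /Hr[]].
  - by move=> x z /rho1r[xr _] /rho1r[zr _]; exact: chord.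
  - by move=> x /rho1r[_ /Hr[]].
  - by rewrite cyp; exact: up0.
have h1 : \forall q \near p0, u (chart_inv c (chart_map c q)) = 2 * k%:R :=
  chart_map_continuous cp claim.
have h2 := open_nbhs_nbhs (conj (@chart_dom_open _ _ _ c) cp).
by apply: filterS2 h1 h2 => q hq cq; move: hq; rewrite chart_mapK.
Qed.

Hypothesis hproper : proper_map X.

(* The complement of the contact set; as u >= 2k, it is also the set u > 2k. *)
Let W := [set p | u p != 2 * k%:R].

Let u_continuous : continuous u.
Proof.
have [Xc _] := hproper; move=> p.
apply: (@continuous_comp _ _ _ X (fun v => dot (front k v) (front k v))).
  exact: Xc.
exact: continuous_front2.
Qed.

Let norm2_continuous : continuous (fun p => dot (X p) (X p)).
Proof.
have [Xc _] := hproper; move=> p.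
apply: (@continuous_comp _ _ _ X (fun v => dot v v)); first exact: Xc.
exact: continuous_norm2.
Qed.

Let W_open : open W.
Proof.
have -> : W = u @^-1` [set x | 2 * k%:R < x].
  apply/seteqP; split=> p /= h; first by rewrite lt_neqAle eq_sym h u_ge.
  by rewrite /W /= gt_eqF.
by apply: open_comp => [p _|]; [exact: u_continuous | exact: open_gt].
Qed.

Let W_closed : closed W.
Proof.
have -> : W = ~` [set p | u p = 2 * k%:R].
  by apply/seteqP; split=> p /= /eqP.
apply: open_closedC; rewrite openE => p up; exact: contact_set_open.
Qed.

Let W_compact (B : R) : compact (W `&` [set p | dot (X p) (X p) <= B]).
Proof.
rewrite setIC; apply: compact_closedI => //.
have [_ h] := hproper; exact: (h _ (@compact_norm2_le R m B)).
Qed.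

(** Outside the compact part |X|^2 <= B of [W] the penalty alone exceeds the
    value at p1, so the minimum over this part is a minimum over [W], and a local
    one on the manifold because [W] is open. *)
Lemma penalized_minimum (eps : R) : 0 < eps -> eps <= 1 -> W !=set0 ->
  exists2 p, W p & 0 <= 2 * k%:R - u p + eps ^+ 2 * dot (X p) (X p)
                        + eps * (2 * n%:R - dot (X p) (X p)).
Proof.
move=> eps0 eps1 [p1 Wp1].
pose F p := u p + eps * dot (X p) (X p).
have Fc : continuous F.
  move=> p; apply: continuousD; first exact: u_continuous.
  by apply: continuousM; [exact: cst_continuous | exact: norm2_continuous].
pose B := F p1 / eps.
have p1B : (W `&` [set p | dot (X p) (X p) <= B]) p1.
  split => //=; rewrite /B ler_pdivlMr // mulrC /F lerDr.
  exact: dot_ge0.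
have [p /set_mem [Wp pB] pmin] := compact_EVT_min (ex_intro _ p1 p1B)
  (@W_compact B) (continuous_subspaceT Fc).
exists p => //.
have {}pmin q : W q -> F p <= F q.
  move=> Wq; have [qB|qB] := leP (dot (X q) (X q)) B.
    by apply: pmin; apply/mem_set; split.
  apply: (@le_trans _ _ (F p1)); first by apply: pmin; apply/mem_set.
  have : F p1 < eps * dot (X q) (X q) by rewrite mulrC -ltr_pdivrMr.
  rewrite /F => h; apply: le_trans (ltW h) _; rewrite lerDr; exact: dot_ge0.
have near_p : \forall q \near p,
    u p + eps * dot (X p - 0) (X p - 0) <= u q + eps * dot (X q - 0) (X q - 0).
  have : \forall q \near p, W q by exact: open_nbhs_nbhs (conj W_open Wp).
  by apply: filterS => q Wq; rewrite !subr0; exact: pmin.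
have up0 : 0 < u p by apply: lt_le_trans (u_ge2 p).
have hg r : is_derive r (1 : R) (fun s => eps * s) eps.
  apply: (is_derive_eq (is_deriveZ eps (is_derive_id r (1 : R)))).
  exact: mulr1.
have [tau [/andP[tau0 taus] _]] := shrinker_min_test hM hX km hshr up0
  hg (is_derive_cst eps _ (1 : R)) near_p.
rewrite subr0 in taus *; rewrite -/(u p) mulr0 addr0 => ineq.
apply: le_trans ineq _; rewrite lerD2r lerD2l.
apply: (@le_trans _ _ (eps ^+ 2 * tau)); last first.
  by rewrite ler_wpM2l // exprn_ge0 // ltW.
rewrite ler_wpM2r // ler_pdivrMr // mulrC ler_wpM2l //.
by rewrite exprn_ge0 // ltW.
Qed.

(** For eps <= 1/4 a penalized minimum has |X|^2 <= 4n, so this compact part of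
    [W] is not empty and u - 2k has a positive minimum [eta] on it; a penalty
    with 2 n eps < eta contradicts this. *)
Lemma contact_set_full p : u p = 2 * k%:R.
Proof.
have [//|/eqP Wp] := pselect (u p = 2 * k%:R); exfalso.
have W0 : W !=set0 by exists p.
have n0 : 0 <= n%:R :> R by [].
have wge q : 0 <= dot (X q) (X q) := dot_ge0 _.
have [p1 Wp1 ineq1] : exists2 p, W p & 0 <= 2 * k%:R - u p + 4^-1 ^+ 2 * dot (X p) (X p)
                        + 4^-1 * (2 * n%:R - dot (X p) (X p)).
  by apply: penalized_minimum => //; lra.
have p1B : (W `&` [set p | dot (X p) (X p) <= 4 * n%:R]) p1.
  split => //=; move: ineq1; have := u_ge p1; rewrite expr2; lra.
have [p2 /set_mem [/= Wp2 _] p2min] := compact_EVT_min (ex_intro _ p1 p1B)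
  (@W_compact _) (continuous_subspaceT u_continuous).
pose eta := u p2 - 2 * k%:R.
have eta0 : 0 < eta by rewrite subr_gt0 lt_neqAle eq_sym Wp2 u_ge.
have d0 : 0 < 2 * n%:R + 1 :> R by rewrite ltr_wpDl // mulr_ge0.
pose eps := Num.min 4^-1 (eta / (2 * n%:R + 1)).
have eps0 : 0 < eps by rewrite lt_min invr_gt0 divr_gt0 ?andbT.
have eps4 : eps <= 4^-1 by rewrite ge_min lexx.
have epseta : eps * (2 * n%:R + 1) <= eta.
  by rewrite -ler_pdivlMr // ge_min lexx orbT.
have [q Wq ineq] : exists2 p, W p & 0 <= 2 * k%:R - u p + eps ^+ 2 * dot (X p) (X p)
                        + eps * (2 * n%:R - dot (X p) (X p)).
  by apply: penalized_minimum => //; lra.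
have e2 : eps ^+ 2 * dot (X q) (X q) <= eps / 4 * dot (X q) (X q).
  by rewrite ler_wpM2r // expr2 ler_pM2l.
have qB : dot (X q) (X q) <= 4 * n%:R.
  have h : 0 <= eps * (2 * n%:R - 3 / 4 * dot (X q) (X q)).
    by have := u_ge q; lra.
  by move: h; rewrite pmulr_rge0 //; lra.
have uq : u p2 <= u q by apply: p2min; apply/mem_set; split.
have : 0 <= eps * dot (X q) (X q) by rewrite mulr_ge0 // ltW.
by move: uq epseta; rewrite /eta; lra.
Qed.

End Shrinker.

(** * The exterior cylinder *)

Lemma closure_exterior_norm2 (R : realType) d (r : R) (x : 'rV[R]_d) :
  0 <= r -> closure (exterior d r) x -> r ^+ 2 <= dot x x.
Proof.
move=> r0; pose D := [set v : 'rV[R]_d | r ^+ 2 <= dot v v].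
have Dclosed : closed D.
  apply: (@closed_comp _ _ (fun v : 'rV[R]_d => dot v v) [set t | r ^+ 2 <= t]).
    by move=> v _; exact: continuous_norm2.
  exact: closed_ge.
have : exterior d r `<=` D.
  move=> v vE; have /negP : ~ (enorm v < r).
    by move=> vr; apply: vE; exact: subset_closure.
  rewrite -leNgt /D /= => h; rewrite -(sqr_sqrtr (dot_ge0 v)).
  by rewrite ler_pXn2r // nnegrE sqrtr_ge0.
by move=> /closure_subset h /h; rewrite -(closure_id _).1.
Qed.

Lemma dot_cylinder (R : realType) k m (hkm : (k < m)%N) (x : 'rV[R]_m)
    (y := \row_(i < k.+1) x 0 (widen_ord hkm i)) :
  dot y y = dot (front k x) (front k x).
Proof.
rewrite dot_front_front dot_front (big_ord_narrow (F := fun j => x 0 j * x 0 j) hkm).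
by apply: eq_bigr => i _; rewrite !mxE.
Qed.

Theorem theorem15 (R : realType) (n m k : nat)
  (hnm : (n < m)%N) (hk : (1 <= k)%N) (hkn : (k <= n)%N)
  (M : topologicalType) (A : set (chart R n M)) (X : M -> 'rV[R]_m)
  (hM : smooth_manifold A) (hX : immersion A X)
  (hcomplete : complete_immersion A X) (hproper : proper_map X)
  (hshrinker : self_shrinker A X)
  (hsub : range X `<=` cylinder (leq_ltn_trans hkn hnm)
            (closure (exterior k.+1 (Num.sqrt (2 * k%:R))))) :
  range X `<=` cylinder (leq_ltn_trans hkn hnm)
            (esphere k (Num.sqrt (2 * k%:R))).
Proof.
have k2 : 0 <= 2 * k%:R :> R by rewrite mulr_ge0.
move=> _ [p _ <-]; rewrite /cylinder /esphere /= /enorm dot_cylinder.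
congr Num.sqrt; apply: (contact_set_full hM hX _ hk hshrinker) => //.
  exact: leq_ltn_trans hkn hnm.
move=> q; rewrite -(dot_cylinder (leq_ltn_trans hkn hnm)) -[leLHS](sqr_sqrtr k2).
apply: closure_exterior_norm2; first exact: sqrtr_ge0.
by apply: hsub; exists q.
Qed.
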